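(* Let $\mathbf c=(c_1,c_2)\in\mathcal B_1$ with $\Delta_1(\mathbf c)\Delta_2(\mathbf c)\neq0$. Let $e_1<e_2<e_3$ be the real roots of $P_{\mathbf c}$ (where $e_1<e_2<0<e_3$), and let $\lambda_1=-(\lambda_2+\lambda_3)<0<\lambda_2<\lambda_3$ be the roots of $Q_{\mathbf c}$. Let $\tau$ be the periodic solution of $$\tau''=\tau^2-9c_1\tau^{-2}(1-c_1\tau^{-1}),\qquad \tau(0)=e_2,\quad \tau'(0)=0,$$ and for $j=1,2,3$ let $$\phi_j(s)=\int_0^s\frac{3c_1\lambda_j-(4c_1+\lambda_j^2)\tau^2(u)+3\tau^3(u)}{\tau^2(u)\bigl(3\lambda_j-\tau^2(u)\bigr)}\,du .$$ Put $$\rho_1=\frac1{\sqrt{(2\lambda_2+\lambda_3)(\lambda_2+2\lambda_3)}},\quad \rho_2=\frac1{\sqrt{2(\lambda_3-\lambda_2)(2\lambda_2+\lambda_3)}},\quad \rho_3=\frac1{\sqrt{2(\lambda_3-\lambda_2)(\lambda_2+2\lambda_3)}},$$ $$z_1=\rho_1\sqrt{3(\lambda_2+\lambda_3)+\tau^2}\,e^{i\phi_1},\quad z_2=\rho_2\sqrt{3\lambda_2-\tau^2}\,e^{i\phi_2},\quad z_3=\rho_3\sqrt{3\lambda_3-\tau^2}\,e^{i\phi_3},$$ where continuous determinations of the (possibly imaginary) square roots are used, and let $\varepsilon=-\operatorname{sign}(e_2^2-3\lambda_3)$. Then a general critical curve of type $\mathcal B_1'$ with modulus $\mathbf c$ is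 congruent to $$\gamma\colon\mathbb R\ni s\longmapsto\bigl[{}^t\bigl(z_2+z_3,\ \varepsilon i z_1,\ -\varepsilon i(z_2-z_3)\bigr)\bigr]\in\mathcal S .$$ In addition, $\gamma$ is in a standard configuration.
   Context: $\mathbb C^{2,1}$ denotes $\mathbb C^3$ with the Hermitian form $\langle \mathbf z,\mathbf w\rangle={}^t\overline{\mathbf z}\,\mathbf h\,\mathbf w$, $\mathbf h=\begin{pmatrix}0&0&i\\0&1&0\\-i&0&0\end{pmatrix}$ (signature $(2,1)$). $\mathcal S\subset\mathbb{CP}^2$ is the set of null lines, $\mathcal S=\{[\mathbf z]: \langle\mathbf z,\mathbf z\rangle=0\}\cong S^3$. $G=\{A\in SL(3,\mathbb C): {}^t\bar A\mathbf hA=\mathbf h\}$ acts on $\mathcal S$ by $A[\mathbf z]=[A\mathbf z]$. The contact distribution $\mathcal D$ of $\mathcal S$ is the kernel of the real 1-form $\zeta$ obtained by restricting $-i\langle\mathbf z,d\mathbf z\rangle/(\overline{\mathbf z}\cdot\mathbf z)$ to $T\mathcal S$. A smooth immersed curve $\gamma\colon J\to\mathcal S$ is transversal if $\gamma'(t)\notin\mathcal D_{\gamma(t)}$ for all $t$; it is always assumed positively parametrized, i.e. $\zeta(\gamma')>0$. A lift of $\gamma$ is a smooth map $\Gamma$ into the nonzero null vectors with $\gamma=[\Gamma]$. A transversal curve is generic if $\det(\Gamma,\Gamma',\Gamma'')\neq0$ everywhere for one (hence any) lift. A Wilczynski lift is a lift with $\det(\Gamma,\Gamma',\Gamma'')=-1$.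 The infinitesimal strain is $ds=a_\gamma\,dt$, where $a_\gamma=i\langle\Gamma,\Gamma'\rangle^{-1}>0$ for a Wilczynski lift $\Gamma$; the curve is parametrized by the natural parameter if $a_\gamma=1$. For such a generic transversal curve there is a smooth map $\mathcal F=(F_1,F_2,F_3)\colon J\to G$ (a Wilczynski frame, unique up to a constant cube root of unity), with $F_1$ a Wilczynski lift, such that $$\mathcal F^{-1}\mathcal F'=\begin{pmatrix} i\kappa & -i & \tau\\ 0 & -2i\kappa & 1\\ 1 & 0 & i\kappa\end{pmatrix}$$ for smooth real functions $\kappa$ (bending) and $\tau$ (twist). The total CR twist functional is $\mathcal W[\gamma]=\int\tau\,ds$; critical curves are its critical points with respect to compactly supported variations through generic transversal curves. Equivalently, $2\kappa\tau'+\tau\kappa'=0$ and $\tau''+9\kappa(1-\tau\kappa)-\tau^2=0$. Critical curves are taken on their maximal interval of definition. Along a critical curve the matrix $\mathfrak M=\mathcal F L\mathcal F^{-1}$, with $L=\begin{pmatrix}0 & i\tau'+3(1-\tau\kappa) & 2i\tau\\ \tau & 0 & \tau'+3i(1-\tau\kappa)\\ 3i & -i\tau & 0\end{pmatrix}$, is constant; it is the momentum. The quantities $c_1=\kappa\tau^2$ and $c_2=-18\kappa\tau+9\kappa^2\tau^2-\tfrac23\tau^3+\tau'^2$ are constant, and $\mathbf c=(c_1,c_2)$ is the modulus. Put $$P_{\mathbf c}(x)=x^5+\tfrac32c_2x^2+27c_1x-\tfrac{27}2c_1^2,\qquad Q_{\mathbf c}(x)=x^3+6c_1x+(27+3c_2).$$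 The eigenvalues of $\mathfrak M$ are the roots of $Q_{\mathbf c}$, and $\tfrac32\tau^2\tau'^2=P_{\mathbf c}(\tau)$, $\kappa=c_1\tau^{-2}$ if $c_1\ne 0$. Let $\Delta_1(\mathbf c)=-27\bigl(32c_1^3+9(9+c_2)^2\bigr)$ and $\Delta_2(\mathbf c)=9c_1^3(c_1^3+216)+6c_1^3c_2(c_2+36)+(c_2+9)(c_2+18)^3$. $\mathcal B_1$ is the set of $\mathbf c\in\mathbb R^2$ such that $P_{\mathbf c}$ has two non-real roots and three simple real roots $e_1<e_2<e_3$ and $\Delta_1(\mathbf c)>0$ (so $Q_{\mathbf c}$ has three distinct real roots); for such $\mathbf c$ one has $c_1<0$ and $e_1<e_2<0<e_3$. A critical curve with modulus $\mathbf c$ is general if $\Delta_1(\mathbf c)\Delta_2(\mathbf c)\ne0$. It is of type $\mathcal B_1'$ if $\mathbf c\in\mathcal B_1$, its twist is nonconstant, and the image of its signature $s\mapsto(\tau,\sqrt{3/2}\,\tau\tau')$ is the compact connected component of the curve $y^2=P_{\mathbf c}(x)$; equivalently, the twist is nonconstant, periodic, with values filling $[e_1,e_2]$. The natural parameter is normalized by a translation so that the twist is even with $\tau(0)=e_2$. Two curves are congruent if one is the image of the other under an element of $G$. A critical curve of type $\mathcal B_1'$ is in a standard configuration if its momentum equals $$\begin{pmatrix}\tfrac12(\lambda_2+\lambda_3)&0&\tfrac{\varepsilon i}2(\lambda_2-\lambda_3)\\0&\lambda_1&0\\-\tfrac{\varepsilon i}2(\lambda_2-\lambda_3)&0&\tfrac12(\lambda_2+\lambda_3)\end{pmatrix},$$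 with $\varepsilon=-\operatorname{sign}(e_2^2-3\lambda_3)$ (so $\varepsilon=1$ if the $\lambda_3$-eigenspace of the momentum is timelike, $\varepsilon=-1$ if it is spacelike). *)

(* Defs.v *)
From HB Require Import structures.
From mathcomp Require Import all_boot all_order all_algebra.
From mathcomp Require Import complex.
From mathcomp Require Import all_classical all_reals all_analysis.

Set Implicit Arguments.
Unset Strict Implicit.
Unset Printing Implicit Defensive.

Import Order.TTheory GRing.Theory Num.Theory.
Import numFieldNormedType.Exports.

Local Open Scope ring_scope.
Local Open Scope complex_scope.
Local Open Scope classical_set_scope.

Section Defs.
Variable R : realType.
Implicit Types (J : set R) (c : R * R) (kappa tau : R -> R) (s t : R).

Local Notation C := R[i].
Local Notation V := 'cV[C]_3.

Definition col3 (a b d : C) : V := \col_(k < 3) [:: a; b; d]`_k.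

Definition mx3 (rows : seq (seq C)) : 'M[C]_3 :=
  \matrix_(k < 3, l < 3) (nth [::] rows k)`_l.

Definition ctr m n (A : 'M[C]_(m, n)) : 'M[C]_(n, m) := (map_mx (@conjc R) A)^T.

(** ** Smooth maps of a real variable with complex matrix values *)

(* Functions are total on R; only their values on the open set J matter. *)
Definition smooth J (f : R -> R) : Prop :=
  forall n t, J t -> derivable (derive1n n f) t 1.

Definition smooth_mx J m n (F : R -> 'M[C]_(m, n)) : Prop :=
  forall k l, smooth J (fun t => complex.Re (F t k l)) /\
              smooth J (fun t => complex.Im (F t k l)).

Definition deriv_mx m n (F : R -> 'M[C]_(m, n)) t : 'M[C]_(m, n) :=
  \matrix_(k, l) (derive1 (fun u => complex.Re (F u k l)) t
               +i* derive1 (fun u => complex.Im (F u k l)) t).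

Definition open_interval J : Prop := [/\ open J, is_interval J & J !=set0].

(** ** The CR sphere *)

Definition hmx : 'M[C]_3 :=
  mx3 [:: [:: 0; 0; 'i%C]; [:: 0; 1; 0]; [:: - 'i%C; 0; 0]].

Definition herm (z w : V) : C := (ctr z *m hmx *m w) 0 0.

Definition inG (A : 'M[C]_3) : Prop := \det A = 1 /\ ctr A *m hmx *m A = hmx.

(* The point [z] of CP^2 (for z <> 0) is the complex line spanned by z. *)
Definition cline (z : V) : set V := [set w | exists a : C, w = a *: z].

Definition act (A : 'M[C]_3) (p : set V) : set V := (fun w => A *m w) @` p.

Definition det3 (u v w : V) : C :=
  \det (\matrix_(k < 3, l < 3) ([:: u; v; w]`_l) k 0).

(** ** Transversal curves *)

(* A curve is a map from J to complex lines.  Having a lift in the sense below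
   expresses both that the curve is smooth and that it takes values in the
   sphere: over an interval every smooth curve in the sphere has a global
   smooth lift. *)
Definition null_lift J (g : R -> set V) (G : R -> V) : Prop :=
  smooth_mx J G /\
  forall t, J t -> [/\ G t != 0, herm (G t) (G t) = 0 & g t = cline (G t)].

(* zeta(g') for a lift G of g; it is real because G is null. *)
Definition contact (G : R -> V) t : C :=
  - 'i%C * herm (G t) (deriv_mx G t) / (ctr (G t) *m G t) 0 0.

(* Immersed, transversal and positively parametrized.  Recall that 0 < z in
   R[i] means that z is real and positive. *)
Definition transversal J (g : R -> set V) : Prop :=
  open_interval J /\
  exists2 G, null_lift J g G & forall t, J t ->
    ~ cline (G t) (deriv_mx G t) /\ 0 < contact G t.

Definition wdet (G : R -> V) t : C :=
  det3 (G t) (deriv_mx G t) (deriv_mx (deriv_mx G) t).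

Definition generic J (g : R -> set V) : Prop :=
  exists2 G, null_lift J g G & forall t, J t -> wdet G t != 0.

Definition wilczynski_lift J (g : R -> set V) (G : R -> V) : Prop :=
  null_lift J g G /\ forall t, J t -> wdet G t = -1.

Definition strain (G : R -> V) t : C := 'i%C * (herm (G t) (deriv_mx G t))^-1.

Definition natural_parameter J (g : R -> set V) : Prop :=
  exists2 G, wilczynski_lift J g G & forall t, J t -> strain G t = 1.

Definition Kmx (k t : R) : 'M[C]_3 :=
  mx3 [:: [:: 0 +i* k ; - 'i%C          ; t%:C];
          [:: 0       ; 0 +i* (- 2 * k) ; 1];
          [:: 1       ; 0               ; 0 +i* k]].

(* F is a Wilczynski frame along g, with bending kappa and twist tau. *)
Definition wilczynski_frame J (g : R -> set V) (F : R -> 'M[C]_3)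
    (kappa tau : R -> R) : Prop :=
  [/\ smooth_mx J F, smooth J kappa, smooth J tau,
      wilczynski_lift J g (fun t => col 0 (F t)) &
      forall t, J t -> inG (F t) /\
        invmx (F t) *m deriv_mx F t = Kmx (kappa t) (tau t)].

(** ** Critical curves of the total twist *)

(* The Euler-Lagrange equations of the total twist, the integral of tau ds, for
   compactly supported variations through generic transversal curves; by
   definition here, a curve is critical if it satisfies them. *)
Definition euler_lagrange J kappa tau : Prop :=
  forall s, J s ->
    2 * kappa s * derive1 tau s + tau s * derive1 kappa s = 0 /\
    derive1 (derive1 tau) s + 9 * kappa s * (1 - tau s * kappa s)
      - tau s ^+ 2 = 0.

(* g is critical on J, parametrized by the natural parameter, with Wilczynski
   frame F, bending kappa and twist tau. *)
Definition critical J (g : R -> set V) (F : R -> 'M[C]_3)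
    (kappa tau : R -> R) : Prop :=
  [/\ transversal J g, generic J g, natural_parameter J g,
      wilczynski_frame J g F kappa tau & euler_lagrange J kappa tau].

Definition maximal_curve J (g : R -> set V) : Prop :=
  forall J' g' F' kappa' tau', critical J' g' F' kappa' tau' ->
    J `<=` J' -> (forall s, J s -> g' s = g s) -> J' `<=` J.

Definition critical_curve J (g : R -> set V) (F : R -> 'M[C]_3)
    (kappa tau : R -> R) : Prop :=
  critical J g F kappa tau /\ maximal_curve J g.

Definition Lmx (k t t' : R) : 'M[C]_3 :=
  let y := 3 * (1 - t * k) in
  mx3 [:: [:: 0       ; y +i* t'   ; 0 +i* (2 * t)];
          [:: t%:C    ; 0          ; t' +i* y];
          [:: 0 +i* 3 ; 0 +i* (- t); 0]].

Definition has_momentum J (F : R -> 'M[C]_3) kappa tau (M : 'M[C]_3) : Prop :=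
  forall s, J s ->
    F s *m Lmx (kappa s) (tau s) (derive1 tau s) *m invmx (F s) = M.

Definition has_modulus J kappa tau c : Prop :=
  forall s, J s ->
    kappa s * tau s ^+ 2 = c.1 /\
    - 18 * kappa s * tau s + 9 * kappa s ^+ 2 * tau s ^+ 2
      - 2 / 3 * tau s ^+ 3 + (derive1 tau s) ^+ 2 = c.2.

(** ** The modular polynomials *)

Definition Ppoly c : {poly R} :=
  'X^5 + (3 / 2 * c.2) *: 'X^2 + (27 * c.1) *: 'X - (27 / 2 * c.1 ^+ 2)%:P.

Definition Qpoly c : {poly R} :=
  'X^3 + (6 * c.1) *: 'X + (27 + 3 * c.2)%:P.

Definition Delta1 c : R := - 27 * (32 * c.1 ^+ 3 + 9 * (9 + c.2) ^+ 2).

Definition Delta2 c : R :=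
  9 * c.1 ^+ 3 * (c.1 ^+ 3 + 216) + 6 * c.1 ^+ 3 * c.2 * (c.2 + 36)
  + (c.2 + 9) * (c.2 + 18) ^+ 3.

(* P_c has exactly three real roots, all simple, and two non-real roots. *)
Definition B1 c : Prop :=
  0 < Delta1 c /\
  exists (e1 e2 e3 : R) (w1 w2 : C),
    [/\ e1 < e2, e2 < e3, complex.Im w1 != 0, complex.Im w2 != 0 &
        map_poly (real_complex R) (Ppoly c) =
          \prod_(x <- [:: e1%:C; e2%:C; e3%:C; w1; w2]) ('X - x%:P)].

Definition quintic c : set (R * R) := [set p | p.2 ^+ 2 = (Ppoly c).[p.1]].

Definition signature tau s : R * R :=
  (tau s, Num.sqrt (3 / 2) * tau s * derive1 tau s).

Definition type_B1' J tau c : Prop :=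
  [/\ B1 c,
      exists s t, [/\ J s, J t & tau s != tau t] &
      exists2 p, quintic c p &
        compact (connected_component (quintic c) p) /\
        signature tau @` J = connected_component (quintic c) p].

Definition general c : Prop := Delta1 c * Delta2 c != 0.

(** ** Congruence, normalization and standard configurations *)

Definition congruent J (g : R -> set V) J' (g' : R -> set V) : Prop :=
  J = J' /\ exists2 A, inG A & forall s, J s -> g s = act A (g' s).

Definition translate_dom s0 J : set R := [set s | J (s0 + s)].

Definition translate T s0 (f : R -> T) : R -> T := fun s => f (s0 + s).

Definition normalized J tau (e2 : R) : Prop :=
  [/\ J 0, tau 0 = e2 & forall s, J s -> J (- s) /\ tau (- s) = tau s].

(* e2 is the middle real root of P_c and l1 < l2 < l3 are the roots of Q_c. *)
Definition epsilon (e2 l3 : R) : R := - Num.sg (e2 ^+ 2 - 3 * l3).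

Definition standard_momentum (e2 l1 l2 l3 : R) : 'M[C]_3 :=
  let a := ((l2 + l3) / 2)%:C in
  let b := 0 +i* (epsilon e2 l3 / 2 * (l2 - l3)) in
  mx3 [:: [:: a; 0; b]; [:: 0; l1%:C; 0]; [:: - b; 0; a]].

Definition in_standard_configuration J (g : R -> set V) c (e2 l1 l2 l3 : R) :
    Prop :=
  exists F kappa tau,
    [/\ critical_curve J g F kappa tau, has_modulus J kappa tau c,
        type_B1' J tau c &
        has_momentum J F kappa tau (standard_momentum e2 l1 l2 l3)].

(** ** The explicit curve *)

Definition twist_solution c (e2 : R) tau : Prop :=
  [/\ tau 0 = e2, derive1 tau 0 = 0,
      exists2 T, 0 < T & periodic tau T &
      forall s, [/\ tau s != 0, derivable tau s 1, derivable (derive1 tau) s 1 &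
        derive1 (derive1 tau) s =
          tau s ^+ 2 - 9 * c.1 / tau s ^+ 2 * (1 - c.1 / tau s)]].

Definition oriented_integral0 (f : R -> R) s : R :=
  if 0 <= s then \int[lebesgue_measure]_(u in `[0, s]) f u
  else - \int[lebesgue_measure]_(u in `[s, 0]) f u.

Definition phi c tau (l : R) s : R :=
  oriented_integral0 (fun u =>
    (3 * c.1 * l - (4 * c.1 + l ^+ 2) * tau u ^+ 2 + 3 * tau u ^+ 3)
    / (tau u ^+ 2 * (3 * l - tau u ^+ 2))) s.

Definition rho1 (l2 l3 : R) : R :=
  (Num.sqrt ((2 * l2 + l3) * (l2 + 2 * l3)))^-1.
Definition rho2 (l2 l3 : R) : R :=
  (Num.sqrt (2 * (l3 - l2) * (2 * l2 + l3)))^-1.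
Definition rho3 (l2 l3 : R) : R :=
  (Num.sqrt (2 * (l3 - l2) * (l2 + 2 * l3)))^-1.

Definition cexpi (x : R) : C := cos x +i* sin x.

Definition sqrt_determination (f : R -> R) (r : R -> C) : Prop :=
  [/\ continuous (fun s => complex.Re (r s)),
      continuous (fun s => complex.Im (r s)) &
      forall s, r s ^+ 2 = (f s)%:C].

(* r1, r2, r3 are determinations of the square roots entering z1, z2, z3. *)
Definition explicit_curve c (e2 l1 l2 l3 : R) tau (r1 r2 r3 : R -> C) s :
    set V :=
  let z1 := (rho1 l2 l3)%:C * r1 s * cexpi (phi c tau l1 s) in
  let z2 := (rho2 l2 l3)%:C * r2 s * cexpi (phi c tau l2 s) in
  let z3 := (rho3 l2 l3)%:C * r3 s * cexpi (phi c tau l3 s) in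
  let ei := 0 +i* epsilon e2 l3 in
  cline (col3 (z2 + z3) (ei * z1) (- ei * (z2 - z3))).

End Defs.

(* Main.v *)
(* A critical curve is determined, up to G, by its twist: its Wilczynski frame F
   solves F' = F K, and two solutions with values in G differ by a constant left
   factor in G.  The momentum M = F L F^-1 is constant, so in an eigenbasis of M
   the rows of F are left eigenvectors of L with eigenvalues l1, l2, l3; hence the
   row for l is z (1, q, w) with q and w rational in (tau, tau', l), and F' = F K
   becomes z' = z (tau tau' / (tau^2 - 3 l) + i phi') for the phases phi of the
   statement.  This yields a frame of the explicit curve.  The eigenvalues being
   real and distinct, the rows are h-orthogonal, and their norms can be computed,
   so that the frame lies in G once it is rescaled by a cube root of its constant
   determinant.

   The denominators do not vanish: 54 P(x) = 27 x^2 Q(x^2/3) - (x^4 - 27 x + 27 c1)^2,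
   so Q(x^2/3) >= 0 where P >= 0, with equality only if Delta2 = 0; therefore
   tau^2 stays below 3 l2 or above 3 l3.

   Conversely, the twist of a curve of type B1' passes through e2 with zero
   derivative, hence is a translate of tau; the frames then agree up to G, and
   the explicit curve, defined on the whole line, extends the given one, which is
   therefore defined on the whole line by maximality. *)

Require Import Defs.
From mathcomp Require Import all_boot all_order all_algebra.
From mathcomp Require Import complex.
From mathcomp Require Import all_classical all_reals all_analysis.
From mathcomp Require Import ring lra.
Import Order.TTheory GRing.Theory Num.Theory.
Import numFieldNormedType.Exports.
Local Open Scope ring_scope.
Local Open Scope complex_scope.
Local Open Scope classical_set_scope.

Set Implicit Arguments.
Unset Strict Implicit.
Unset Printing Implicit Defensive.

(** * Calculus of real and complex functions of a real variable *)

Section Calculus.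
Variable R : realType.
Implicit Types (f g E : R -> R) (J : set R) (a b s t : R).

Lemma is_derive_add f g t a b : is_derive t 1 f a -> is_derive t 1 g b ->
  is_derive t 1 (fun u => f u + g u) (a + b).
Proof. exact: is_deriveD. Qed.

Lemma is_derive_opp f t a : is_derive t 1 f a ->
  is_derive t 1 (fun u => - f u) (- a).
Proof. exact: is_deriveN. Qed.

Lemma is_derive_mul f g t a b : is_derive t 1 f a -> is_derive t 1 g b ->
  is_derive t 1 (fun u => f u * g u) (a * g t + f t * b).
Proof.
move=> fa gb; have /is_derive_eq : is_derive t 1 (f * g) (f t *: b + g t *: a).
  exact: is_deriveM.
by apply; rewrite addrC mulrC.
Qed.

Lemma is_derive_inv f t a : f t != 0 -> is_derive t 1 f a ->
  is_derive t 1 (fun u => (f u)^-1) (- (f t) ^- 2 * a).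
Proof. by move=> ft fa; exact: is_deriveV. Qed.

Lemma is_derive_sqr f t a : is_derive t 1 f a ->
  is_derive t 1 (fun u => f u ^+ 2) (2 * f t * a).
Proof.
move=> fa; under eq_fun do rewrite expr2.
by have /is_derive_eq := is_derive_mul fa fa; apply; ring.
Qed.

Lemma is_derive_shiftl f s t a : is_derive (s + t) 1 f a ->
  is_derive t 1 (fun u => f (s + u)) a.
Proof.
move=> fa.
have st : is_derive t 1 (fun u => s + u) 1.
  by have := is_derive_add (is_derive_cst s t 1)
    (is_derive_id t (1 : R)); rewrite add0r.
have := is_derive1_comp fa st.
by move/is_derive_eq; apply; rewrite mulr1.
Qed.

Lemma is_derive_reflect f t a : is_derive (- t) 1 f a ->
  is_derive t 1 (fun u => f (- u)) (- a).
Proof.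
move=> fa.
have := is_derive1_comp fa (is_derive_opp (is_derive_id t (1 : R))).
by move/is_derive_eq; apply; rewrite mulrN1.
Qed.

Lemma is_derive_derive1 f t a : is_derive t 1 f a -> derive1 f t = a.
Proof. by move=> fa; rewrite derive1E derive_val. Qed.

Lemma derivable_is_derive1 f t : derivable f t 1 ->
  is_derive t 1 f (derive1 f t).
Proof. by move=> df; rewrite derive1E; exact: derivableP. Qed.

Lemma is_derive_continuous f t a : is_derive t 1 f a -> {for t, continuous f}.
Proof. by move=> [df _]; apply: differentiable_continuous; apply/derivable1_diffP. Qed.

Lemma is_interval_between J s t u : is_interval J -> J s -> J t ->
  s <= u <= t -> J u.
Proof. by move=> iJ Js Jt; exact: iJ. Qed.

Lemma le0_derive_le f (df : R -> R) a b : a <= b ->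
  (forall u, a <= u <= b -> is_derive u 1 f (df u)) ->
  (forall u, a <= u <= b -> df u <= 0) -> f b <= f a.
Proof.
move=> ab fd df0.
have cf : {within `[a, b], continuous f}.
  apply: continuous_in_subspaceT => u /[!inE] /= /[!in_itv] /= uab.
  exact: is_derive_continuous (fd u uab).
have [u|c cab] := @MVT_segment R f df a b ab _ cf.
  by rewrite in_itv /= => /andP[/ltW au /ltW ub]; apply: fd; rewrite au ub.
move: cab; rewrite in_itv /= => cab e.
rewrite -subr_le0 e mulr_le0_ge0 ?subr_ge0//.
exact: df0.
Qed.

Lemma derive0_const J f a b : is_interval J ->
  (forall u, J u -> is_derive u 1 f 0) -> J a -> J b -> f a = f b.
Proof.
move=> iJ f0.
suff le : forall x y g, (forall u, J u -> is_derive u 1 g 0) ->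
    x <= y -> J x -> J y -> g y <= g x.
  wlog ab : a b / a <= b => [hw Ja Jb|Ja Jb].
    by case/orP: (le_total a b) => ?; [|symmetry]; apply: hw.
  apply/eqP; rewrite eq_le (le a b)// andbT -lerN2.
  apply: (le a b (fun u => - f u)) => // u Ju.
  by rewrite -oppr0; apply: is_derive_opp; exact: f0.
move=> x y g g0 xy Jx Jy; apply: (@le0_derive_le g (fun=> 0)) => // u uxy.
exact: g0 (is_interval_between iJ Jx Jy uxy).
Qed.

(* Gronwall: [E exp(-M u)] decreases to the right of [s0], and [E exp(M u)]
   increases to its left. *)
Lemma gronwall0 J E (dE : R -> R) M s0 : is_interval J -> J s0 -> E s0 = 0 ->
  (forall u, J u -> is_derive u 1 E (dE u)) ->
  (forall u, J u -> 0 <= E u /\ `|dE u| <= M * E u) ->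
  forall s, J s -> E s = 0.
Proof.
move=> iJ Js0 E0 Ed Eb s Js.
have expd (k u : R) : is_derive u 1 (fun v : R => expR (k * v)) (expR (k * u) * k).
  have kd : is_derive u 1 (fun v : R => k * v) k.
    have := is_derive_mul (is_derive_cst k u 1) (is_derive_id u (1 : R)).
    by rewrite mul0r add0r mulr1.
  exact: (is_derive1_comp (is_derive_expR _) kd).
suff: E s <= 0 by move=> Es; apply/eqP; rewrite eq_le Es; case: (Eb s Js).
have [ss0|/ltW ss0] := leP s0 s.
- have : E s * expR (- M * s) <= E s0 * expR (- M * s0).
    apply: (@le0_derive_le (fun u => E u * expR (- M * u))
      (fun u => dE u * expR (- M * u) + E u * (expR (- M * u) * - M))) => // u us.
      exact: (is_derive_mul (Ed u (is_interval_between iJ Js0 Js us))).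
    have Ju := is_interval_between iJ Js0 Js us.
    have -> : dE u * expR (- M * u) + E u * (expR (- M * u) * - M) =
      (dE u - M * E u) * expR (- M * u) by ring.
    rewrite pmulr_lle0 ?expR_gt0//.
    case: (Eb u Ju) => _ /(le_trans (ler_norm _)); lra.
  by rewrite E0 mul0r pmulr_lle0 ?expR_gt0.
- have : - (E s0 * expR (M * s0)) <= - (E s * expR (M * s)).
    apply: (@le0_derive_le (fun u => - (E u * expR (M * u)))
      (fun u => - (dE u * expR (M * u) + E u * (expR (M * u) * M)))) => // u us.
      apply: is_derive_opp.
      exact: (is_derive_mul (Ed u (is_interval_between iJ Js Js0 us))).
    have Ju := is_interval_between iJ Js Js0 us.
    have -> : - (dE u * expR (M * u) + E u * (expR (M * u) * M)) =
      (- dE u - M * E u) * expR (M * u) by ring.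
    rewrite pmulr_lle0 ?expR_gt0//.
    have [_] := Eb u Ju; rewrite -normrN => /(le_trans (ler_norm _)); lra.
  by rewrite E0 mul0r oppr0 oppr_ge0 pmulr_lle0 ?expR_gt0.
Qed.

(** A change of sign would produce a zero by the intermediate value theorem. This is what selects
    one branch: of the twist, of a radicand, of a square root. *)
Lemma continuous_nonvanishing_sg J f s t : is_interval J ->
  (forall u, J u -> {for u, continuous f}) -> (forall u, J u -> f u != 0) ->
  J s -> J t -> Num.sg (f s) = Num.sg (f t).
Proof.
move=> iJ cf f0.
wlog st : s t / s <= t => [hw Js Jt|Js Jt].
  by case/orP: (le_total s t) => ?; [|symmetry]; apply: hw.
have fs := f0 s Js; have ft := f0 t Jt.
have cf' : {within `[s, t], continuous f}.
  apply: continuous_in_subspaceT => u /[!inE] /= /[!in_itv] /= ust.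
  exact: cf (is_interval_between iJ Js Jt ust).
have noroot : ~ (Num.min (f s) (f t) <= 0 <= Num.max (f s) (f t)).
  move=> /(IVT st cf')[u]; rewrite in_itv /= => ust fu.
  by have := f0 u (is_interval_between iJ Js Jt ust); rewrite fu eqxx.
case: (ltrgtP (f s) 0) fs => // fs _; case: (ltrgtP (f t) 0) ft => // ft _.
- by rewrite !ltr0_sg.
- by case: noroot; rewrite ge_min le_max (ltW fs) (ltW ft) orbT.
- by case: noroot; rewrite ge_min le_max (ltW fs) (ltW ft) orbT.
- by rewrite !gtr0_sg.
Qed.

(** [smooth] speaks of all iterated derivatives. Membership in such an algebra is an invariant of
    differentiation and spares explicit formulas for them. *)
Inductive poly_alg (G : set (R -> R)) : set (R -> R) :=
| poly_alg_cst a : poly_alg G (fun=> a)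
| poly_alg_gen f : G f -> poly_alg G f
| poly_alg_add f g : poly_alg G f -> poly_alg G g ->
    poly_alg G (fun u => f u + g u)
| poly_alg_mul f g : poly_alg G f -> poly_alg G g ->
    poly_alg G (fun u => f u * g u).

Lemma poly_alg_opp G f : poly_alg G f -> poly_alg G (fun u => - f u).
Proof.
move=> Gf; have -> : (fun u => - f u) = (fun u => -1 * f u).
  by apply/funext => u; rewrite mulN1r.
by apply: poly_alg_mul => //; exact: poly_alg_cst.
Qed.

(* An algebra generated by functions whose derivatives stay in it is stable
   under differentiation, hence consists of smooth functions. *)
Lemma poly_alg_smooth (G : set (R -> R)) :
  (forall g, G g -> exists2 dg, poly_alg G dg &
     forall t, is_derive t 1 g (dg t)) ->
  forall f, poly_alg G f -> smooth setT f.
Proof.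
move=> Gd.
have dalg f : poly_alg G f -> exists2 df, poly_alg G df &
    forall t, is_derive t 1 f (df t).
  elim=> {f} [a|f Gf|f g Gf [df Gdf fd] Gg [dg Gdg gd]|f g Gf [df Gdf fd] Gg [dg Gdg gd]].
  - exists (fun=> 0); first exact: poly_alg_cst.
    by move=> t; exact: is_derive_cst.
  - exact: Gd.
  - exists (fun t => df t + dg t); first exact: poly_alg_add.
    by move=> t; exact: is_derive_add.
  - exists (fun t => df t * g t + f t * dg t).
      by apply: poly_alg_add; exact: poly_alg_mul.
    by move=> t; exact: is_derive_mul.
have nalg n f : poly_alg G f -> poly_alg G (derive1n n f).
  elim: n => [//|n IH] /IH /dalg[df Gdf fd]; rewrite derive1nS.
  suff -> : derive1 (derive1n n f) = df by [].
  by apply/funext => t; exact: is_derive_derive1.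
by move=> f Gf n t _; have [df _ /(_ t)[]] := dalg _ (nalg n _ Gf).
Qed.

End Calculus.

(** * Derivatives of complex and matrix functions of a real variable *)

Section ComplexCalculus.
Variable R : realType.
Local Notation C := R[i].
Implicit Types (f g : R -> C) (x y a b : C) (s t : R).

Lemma ReM x y : complex.Re (x * y) =
  complex.Re x * complex.Re y - complex.Im x * complex.Im y.
Proof. by case: x y => [? ?] [? ?]. Qed.

Lemma ImM x y : complex.Im (x * y) =
  complex.Re x * complex.Im y + complex.Im x * complex.Re y.
Proof. by case: x y => [? ?] [? ?]. Qed.

Lemma ReD x y : complex.Re (x + y) = complex.Re x + complex.Re y.
Proof. by case: x y => [? ?] [? ?]. Qed.

Lemma ImD x y : complex.Im (x + y) = complex.Im x + complex.Im y.
Proof. by case: x y => [? ?] [? ?]. Qed.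

Lemma complex_eq x y :
  complex.Re x = complex.Re y -> complex.Im x = complex.Im y -> x = y.
Proof. by case: x y => [? ?] [? ?] /= -> ->. Qed.

(** Differentiation goes through real and imaginary parts, as in [deriv_mx]; the relation carries
    derivability together with the value of the derivative. *)
Definition is_cderive f t (d : C) : Prop :=
  is_derive t 1 (fun u => complex.Re (f u)) (complex.Re d) /\
  is_derive t 1 (fun u => complex.Im (f u)) (complex.Im d).

Lemma is_cderive_cst a t : is_cderive (fun=> a) t 0.
Proof. by split; exact: is_derive_cst. Qed.

Lemma is_cderive_add f g t a b : is_cderive f t a -> is_cderive g t b ->
  is_cderive (fun u => f u + g u) t (a + b).
Proof.
move=> [fr fi] [gr gi]; split.
- rewrite ReD; under eq_fun do rewrite ReD; exact: is_derive_add.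
- rewrite ImD; under eq_fun do rewrite ImD; exact: is_derive_add.
Qed.

Lemma is_cderive_mul f g t a b : is_cderive f t a -> is_cderive g t b ->
  is_cderive (fun u => f u * g u) t (a * g t + f t * b).
Proof.
move=> [fr fi] [gr gi]; split.
- under eq_fun do rewrite ReM.
  have := is_derive_add (is_derive_mul fr gr) (is_derive_opp (is_derive_mul fi gi)).
  by move/is_derive_eq; apply; rewrite ReD !ReM; ring.
- under eq_fun do rewrite ImM.
  have := is_derive_add (is_derive_mul fr gi) (is_derive_mul fi gr).
  by move/is_derive_eq; apply; rewrite ImD !ImM; ring.
Qed.

Lemma is_cderive_eq f t a b : is_cderive f t a -> a = b -> is_cderive f t b.
Proof. by move=> + <-. Qed.

Lemma is_cderive_scale f t a b : is_cderive f t a ->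
  is_cderive (fun u => b * f u) t (b * a).
Proof.
move=> /(is_cderive_mul (is_cderive_cst b t))/is_cderive_eq; apply.
by rewrite mul0r add0r.
Qed.

Lemma is_cderive_conj f t a : is_cderive f t a ->
  is_cderive (fun u => (f u)^*) t a^*.
Proof.
have ReJ x : complex.Re x^* = complex.Re x by case: x.
have ImJ x : complex.Im x^* = - complex.Im x by case: x.
move=> [fr fi]; split.
- by rewrite ReJ; under eq_fun do rewrite ReJ.
- by rewrite ImJ; under eq_fun do rewrite ImJ; exact: is_derive_opp.
Qed.

Lemma is_cderive_sum (I : Type) (r : seq I) (h : I -> R -> C) (dh : I -> C) t :
  (forall i, is_cderive (h i) t (dh i)) ->
  is_cderive (fun u => \sum_(i <- r) h i u) t (\sum_(i <- r) dh i).
Proof.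
move=> hd; elim: r => [|i r IH].
  by under eq_fun do rewrite big_nil; rewrite big_nil; exact: is_cderive_cst.
by under eq_fun do rewrite big_cons; rewrite big_cons; exact: is_cderive_add.
Qed.

Lemma is_cderive_shiftl f s t a : is_cderive f (s + t) a ->
  is_cderive (fun u => f (s + u)) t a.
Proof.
by move=> [fr fi]; split; [exact: is_derive_shiftl fr|exact: is_derive_shiftl fi].
Qed.

Lemma is_cderive0_const (J : set R) f s t : is_interval J ->
  (forall u, J u -> is_cderive f u 0) -> J s -> J t -> f s = f t.
Proof.
move=> iJ f0 Js Jt; apply: complex_eq.
- by apply: (derive0_const (f := fun u => complex.Re (f u)) iJ _ Js Jt) => u /f0[].
- by apply: (derive0_const (f := fun u => complex.Im (f u)) iJ _ Js Jt) => u /f0[].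
Qed.

Definition is_mxderive m n (F : R -> 'M[C]_(m, n)) t (D : 'M[C]_(m, n)) : Prop :=
  forall k l, is_cderive (fun u => F u k l) t (D k l).

Lemma deriv_mxE m n (F : R -> 'M[C]_(m, n)) t D :
  is_mxderive F t D -> deriv_mx F t = D.
Proof.
move=> FD; apply/matrixP => k l; rewrite mxE; have [Fr Fi] := FD k l.
by rewrite (is_derive_derive1 Fr) (is_derive_derive1 Fi); case: (D k l).
Qed.

Lemma smooth_is_mxderive J m n (F : R -> 'M[C]_(m, n)) t :
  smooth_mx J F -> J t -> is_mxderive F t (deriv_mx F t).
Proof.
move=> FJ Jt k l; have [Fr Fi] := FJ k l; rewrite mxE; split => /=.
- exact: derivable_is_derive1 (Fr 0 t Jt).
- exact: derivable_is_derive1 (Fi 0 t Jt).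
Qed.

Lemma is_mxderive_eq m n (F : R -> 'M[C]_(m, n)) t D D' :
  is_mxderive F t D -> D = D' -> is_mxderive F t D'.
Proof. by move=> + <-. Qed.

Lemma is_mxderive_mul m n p (F : R -> 'M[C]_(m, n)) (G : R -> 'M[C]_(n, p)) t A B :
  is_mxderive F t A -> is_mxderive G t B ->
  is_mxderive (fun u => F u *m G u) t (A *m G t + F t *m B).
Proof.
move=> FA GB k l; rewrite !mxE -big_split/=.
under eq_fun do rewrite mxE.
by apply: is_cderive_sum => j; exact: is_cderive_mul.
Qed.

Lemma is_mxderive_cst m n (A : 'M[C]_(m, n)) t : is_mxderive (fun=> A) t 0.
Proof. by move=> k l; rewrite mxE; exact: is_cderive_cst. Qed.

Lemma is_mxderive_mull m n p (A : 'M[C]_(m, n)) (F : R -> 'M[C]_(n, p)) t D :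
  is_mxderive F t D -> is_mxderive (fun u => A *m F u) t (A *m D).
Proof.
move=> /(is_mxderive_mul (is_mxderive_cst A t))/is_mxderive_eq; apply.
by rewrite mul0mx add0r.
Qed.

Lemma is_mxderive_ctr m n (F : R -> 'M[C]_(m, n)) t D :
  is_mxderive F t D -> is_mxderive (fun u => ctr (F u)) t (ctr D).
Proof.
move=> FD k l; rewrite !mxE; under eq_fun do rewrite !mxE.
exact: is_cderive_conj.
Qed.

Lemma is_mxderive_shiftl m n (F : R -> 'M[C]_(m, n)) s t D :
  is_mxderive F (s + t) D -> is_mxderive (fun u => F (s + u)) t D.
Proof. by move=> FD k l; exact: is_cderive_shiftl (FD k l). Qed.

End ComplexCalculus.

(** * Indices, sums and determinants in dimension three *)

Local Notation i0 := (@Ordinal 3 0 isT).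
Local Notation i1 := (@Ordinal 3 1 isT).
Local Notation i2 := (@Ordinal 3 2 isT).

Section Dimension3.

Lemma ord3_ind (P : 'I_3 -> Prop) : P i0 -> P i1 -> P i2 -> forall k, P k.
Proof.
move=> P0 P1 P2 [[|[|[|//]]] Hk];
  by [rewrite (bool_irrelevance Hk isT)].
Qed.

Lemma sum3E (V : nmodType) (f : 'I_3 -> V) : \sum_k f k = f i0 + f i1 + f i2.
Proof.
rewrite !big_ord_recl big_ord0 addr0 addrA.
by congr (f _ + f _ + f _); exact/val_inj.
Qed.

Lemma det3E (K : comNzRingType) (A : 'M[K]_3) : \det A =
  A i0 i0 * (A i1 i1 * A i2 i2 - A i1 i2 * A i2 i1)
  - A i0 i1 * (A i1 i0 * A i2 i2 - A i1 i2 * A i2 i0)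
  + A i0 i2 * (A i1 i0 * A i2 i1 - A i1 i1 * A i2 i0).
Proof.
rewrite (expand_det_row _ i0) sum3E /cofactor.
rewrite ![\det _](expand_det_row _ ord0) !big_ord_recl !big_ord0 /cofactor.
rewrite !det_mx11 !mxE.
(* Reading the entries through natural numbers lets the lifted ordinals of the two cofactor
   expansions compare by computation. *)
have [a e] : exists a : nat -> nat -> K, forall p q, A p q = a p q.
  by exists (fun k l => A (inord k) (inord l)) => p q; rewrite !inord_val.
rewrite !e /= /bump /= !addr0 !add0n !expr0 !expr1; ring.
Qed.

End Dimension3.
(** * Wilczynski frames *)

Section Frames.
Variable R : realType.
Local Notation C := R[i].
Local Notation "'h'" := (hmx R).
Implicit Types (A B : 'M[C]_3) (F : R -> 'M[C]_3) (J : set R).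

Lemma ctrM m n p (A : 'M[C]_(m, n)) (B : 'M[C]_(n, p)) :
  ctr (A *m B) = ctr B *m ctr A.
Proof. by rewrite /ctr map_mxM trmx_mul. Qed.

Lemma det_ctr A : \det (ctr A) = (\det A)^*.
Proof. by rewrite /ctr det_tr det_map_mx. Qed.

Lemma hmx_sq : h *m h = 1%:M.
Proof.
by apply/matrixP; apply: ord3_ind; apply: ord3_ind; rewrite !mxE sum3E !mxE /=;
  apply: complex_eq; rewrite /= ?mulrN ?mul0r ?mulr0 ?mulr1 ?subr0 ?oppr0 ?addr0 ?add0r ?opprK.
Qed.

(** This places [Kmx k t] in the Lie algebra of the unitary group of [h]. *)
Lemma Kmx_skew (k t : R) : ctr (Kmx k t) *m h + h *m Kmx k t = 0.
Proof.
by apply/matrixP; apply: ord3_ind; apply: ord3_ind; rewrite !mxE !sum3E !mxE /=;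
  apply: complex_eq => /=; ring.
Qed.

Lemma hmx_form_inv A : ctr A *m h *m A = h -> A *m (h *m ctr A *m h) = 1%:M.
Proof.
by move=> AA; apply: mulmx1C; rewrite -!mulmxA (mulmxA (ctr A)) AA hmx_sq.
Qed.

(** Since [h] is its own inverse, each relation says that [h *m ctr A *m h] is an inverse of [A], on
    one side or the other. The hypothesis is the form natural for a matrix known by its rows. *)
Lemma hmx_coform A : A *m h *m ctr A = h -> ctr A *m h *m A = h.
Proof.
move=> AA.
have : h *m ctr A *m (h *m A) = 1%:M.
  apply: mulmx1C; rewrite mulmxA -(mulmxA h A) -(mulmxA h) AA; exact: hmx_sq.
rewrite mulmxA => /(congr1 (mulmx h)).
by rewrite mulmx1 !mulmxA hmx_sq mul1mx.
Qed.

Lemma inG_unit A : inG A -> A \in unitmx.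
Proof. by move=> [dA _]; rewrite unitmxE dA unitr1. Qed.

(** The right side is linear in the conjugate entries, so the inverse of a frame can be
    differentiated directly. *)
Lemma inG_inv A : inG A -> invmx A = h *m ctr A *m h.
Proof.
move=> GA; have AA := hmx_form_inv GA.2.
by rewrite -[LHS]mulmx1 -AA mulKmx// inG_unit.
Qed.

Lemma inG_mul A B : inG A -> inG B -> inG (A *m B).
Proof.
move=> [dA hA] [dB hB]; split; first by rewrite det_mulmx dA dB mulr1.
by rewrite ctrM !mulmxA -(mulmxA (ctr B)) -(mulmxA (ctr B)) hA.
Qed.

Lemma inG_invmx A : inG A -> inG (invmx A).
Proof.
move=> GA; split; first by rewrite det_inv GA.1 invr1.
have AV := mulmxV (inG_unit GA).
rewrite -{1}GA.2 !mulmxA -ctrM AV -!mulmxA AV mulmx1.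
by rewrite /ctr map_mx1 trmx1 mul1mx.
Qed.

(* [F1 F2^-1 = F1 h F2^* h] has zero derivative because [K^* h + h K = 0]. *)
Lemma frame_unique J F1 F2 (kappa tau : R -> R) : is_interval J -> J !=set0 ->
  (forall u, J u -> is_mxderive F1 u (F1 u *m Kmx (kappa u) (tau u))) ->
  (forall u, J u -> is_mxderive F2 u (F2 u *m Kmx (kappa u) (tau u))) ->
  (forall u, J u -> inG (F1 u)) -> (forall u, J u -> inG (F2 u)) ->
  exists2 A, inG A & forall u, J u -> F1 u = A *m F2 u.
Proof.
move=> iJ [s Js] F1d F2d F1G F2G.
pose A u := F1 u *m (h *m ctr (F2 u) *m h).
have AE u : J u -> A u = F1 u *m invmx (F2 u) by move=> Ju; rewrite inG_inv//; exact: F2G.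
exists (A s); first by rewrite AE//; apply: inG_mul; [exact: F1G|apply: inG_invmx; exact: F2G].
have Ad u : J u -> is_mxderive A u 0.
  move=> Ju; have d2 := is_mxderive_mull h (is_mxderive_ctr (F2d u Ju)).
  have := is_mxderive_mul (F1d u Ju) (is_mxderive_mul d2 (is_mxderive_cst h u)).
  move/is_mxderive_eq; apply; rewrite mulmx0 addr0 ctrM !mulmxA.
  set K := Kmx _ _.
  have Kh : h *m ctr K = - (K *m h).
    have /eqP := Kmx_skew (kappa u) (tau u); rewrite addr_eq0 => /eqP/(congr1 (mulmx h)).
    rewrite mulmxA mulmxN mulmxA hmx_sq mul1mx => /(congr1 (mulmxr h)) /=.
    by rewrite -mulmxA hmx_sq mulmx1 mulNmx.
  rewrite -(mulmxA _ h (ctr K)) Kh mulmxN !mulNmx !mulmxA; apply/eqP.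
  by rewrite addr_eq0 opprK.
move=> u Ju; have -> : A s = A u.
  apply/matrixP => k l; apply: (is_cderive0_const (f := fun v => A v k l) iJ _ Js Ju) => v Jv.
  by have := Ad v Jv k l; rewrite mxE.
by rewrite AE// mulmxKV// inG_unit//; exact: F2G.
Qed.

Lemma cline_scale (a : C) (z : 'cV[C]_3) : a != 0 -> cline (a *: z) = cline z.
Proof.
move=> a0; apply/seteqP; split=> w [b ->].
  by exists (b * a); rewrite scalerA.
by exists (b / a); rewrite scalerA divfK.
Qed.

Lemma act_cline A (z : 'cV[C]_3) : act A (cline z) = cline (A *m z).
Proof.
apply/seteqP; split=> w.
  by move=> [_ [a ->] <-]; exists a; rewrite scalemxAr.
by move=> [a ->]; exists (a *: z); [exists a|rewrite scalemxAr].
Qed.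

Lemma herm_col A (k l : 'I_3) : herm (col k A) (col l A) = (ctr A *m h *m A) k l.
Proof.
rewrite /herm !mxE; apply: eq_bigr => j _; rewrite !mxE; congr (_ * _).
by apply: eq_bigr => i _; rewrite !mxE.
Qed.

(** By the columns of K, F1' is F3 modulo F1, and F1'' is F2 modulo F1 and F3; the sign comes from
    exchanging F2 and F3. *)
Lemma wdet_frame F (kappa tau dkappa : R -> R) :
  (forall s, is_mxderive F s (F s *m Kmx (kappa s) (tau s))) ->
  (forall s : R, is_derive s 1 kappa (dkappa s)) ->
  (forall s, deriv_mx (fun u => col 0 (F u)) s =
     (0 +i* kappa s) *: col i0 (F s) + col i2 (F s)) /\
  forall s, wdet (fun u => col 0 (F u)) s = - \det (F s).
Proof.
move=> Fd kd.
have o30 : 0 = i0 :> 'I_3 by exact/val_inj.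
have entry s k : [/\ (F s *m Kmx (kappa s) (tau s)) k i0 =
     F s k i0 * (0 +i* kappa s) + F s k i2 &
     (F s *m Kmx (kappa s) (tau s)) k i2 =
     F s k i0 * (tau s)%:C + F s k i1 + F s k i2 * (0 +i* kappa s)].
  by split; rewrite !mxE sum3E !mxE /=; rewrite ?mulr0 ?mulr1 ?addr0.
have Gd s : deriv_mx (fun u => col 0 (F u)) s =
    (0 +i* kappa s) *: col i0 (F s) + col i2 (F s).
  apply: deriv_mxE => k l; rewrite o30; under eq_fun do rewrite mxE.
  apply: is_cderive_eq (Fd s k i0) _.
  by rewrite !mxE; have [] := entry s k; rewrite mxE => -> _; rewrite mulrC.
split=> // s.
have Gdd : deriv_mx (deriv_mx (fun u => col 0 (F u))) s =
   \col_k ((0 +i* dkappa s) * F s k i0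
      + (0 +i* kappa s) * (F s k i0 * (0 +i* kappa s) + F s k i2)
      + (F s k i0 * (tau s)%:C + F s k i1 + F s k i2 * (0 +i* kappa s))).
  rewrite (funext Gd : deriv_mx _ = _).
  apply: deriv_mxE => k l; rewrite mxE.
  under eq_fun do rewrite !mxE.
  have [e0 e2] := entry s k; rewrite -e0 -e2.
  have ikd : is_cderive (fun u => 0 +i* kappa u) s (0 +i* dkappa s).
    by split=> //=; exact: is_derive_cst.
  by apply: is_cderive_add (Fd s k i2); apply: is_cderive_mul (Fd s k i0).
rewrite /wdet /det3 Gdd Gd !det3E !mxE /=.
rewrite !o30; ring.
Qed.


Lemma herm_scale (z w : 'cV[C]_3) (a : C) : herm z (a *: w) = a * herm z w.
Proof. by rewrite /herm -scalemxAr mxE. Qed.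

Lemma herm_add (z w w' : 'cV[C]_3) : herm z (w + w') = herm z w + herm z w'.
Proof. by rewrite /herm mulmxDr mxE. Qed.

Lemma ctr_mul_gt0 (z : 'cV[C]_3) : z != 0 -> 0 < (ctr z *m z) 0 0.
Proof.
move=> z0; rewrite !mxE.
have term_ge0 k : 0 <= ctr z 0 k * z k 0 by rewrite !mxE mulrC mulcJ_ge0.
rewrite lt_def sumr_ge0// andbT; apply: contra z0.
rewrite psumr_eq0// => /allP zk; apply/eqP/matrixP => k l.
have := zk k; rewrite mem_index_enum => /(_ isT).
rewrite !mxE (ord1 l) mulrC -sqr_normc sqrf_eq0 normr_eq0 => /eqP ->//.
Qed.

End Frames.

(** The second Euler-Lagrange equation after elimination of the bending by [kappa * tau ^+ 2 = c.1].
    Keeping [dtau] as a separate function lets translates and reflections of a solution fit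
    directly. *)
Definition twist_ode (R : realType) (c : R * R) (tau dtau : R -> R) (s : R) : Prop :=
  [/\ tau s != 0, is_derive s 1 tau (dtau s) &
      is_derive s 1 dtau
        (tau s ^+ 2 - 9 * c.1 / tau s ^+ 2 * (1 - c.1 / tau s))].


(** * Critical curves built from frames *)

Section CriticalOfFrame.
Variables (R : realType) (c : R * R) (tau dtau : R -> R) (F : R -> 'M[R[i]]_3).
Hypothesis twist : forall s, twist_ode c tau dtau s.
Let kappa s := c.1 / tau s ^+ 2.
Hypothesis Fd : forall s, is_mxderive F s (F s *m Kmx (kappa s) (tau s)).
Hypothesis FG : forall s, inG (F s).

(** The derivatives of these functions are polynomials in them, by the twist equation and by F' = F
    K. The inverse of [tau] is included because [kappa] and the force are polynomials in it. *)
Let gen : set (R -> R) := [set f | [\/ f = tau, f = dtau, f = (fun u => (tau u)^-1) |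
  exists k l, f = (fun u => complex.Re (F u k l)) \/
              f = (fun u => complex.Im (F u k l))]].

Let gen_tau : poly_alg gen tau. Proof. by apply: poly_alg_gen; apply: Or41. Qed.
Let gen_dtau : poly_alg gen dtau. Proof. by apply: poly_alg_gen; apply: Or42. Qed.
Let gen_tauV : poly_alg gen (fun u => (tau u)^-1).
Proof. by apply: poly_alg_gen; apply: Or43. Qed.
Let gen_Re k l : poly_alg gen (fun u => complex.Re (F u k l)).
Proof. by apply: poly_alg_gen; apply: Or44; exists k, l; left. Qed.
Let gen_Im k l : poly_alg gen (fun u => complex.Im (F u k l)).
Proof. by apply: poly_alg_gen; apply: Or44; exists k, l; right. Qed.

Let gen_kappa : poly_alg gen kappa.
Proof.
have -> : kappa = fun u => c.1 * ((tau u)^-1 * (tau u)^-1).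
  by apply/funext => u; rewrite /kappa -exprVn expr2.
by do ![apply: poly_alg_mul => //]; exact: poly_alg_cst.
Qed.

Let polyK (k l : 'I_3) :
  poly_alg gen (fun u => complex.Re ((F u *m Kmx (kappa u) (tau u)) k l)) /\
  poly_alg gen (fun u => complex.Im ((F u *m Kmx (kappa u) (tau u)) k l)).
Proof.
under eq_fun do rewrite mxE sum3E !ReD !ReM.
under [in X in _ /\ X]eq_fun do rewrite mxE sum3E !ImD !ImM.
have cK (k' l' : 'I_3) : poly_alg gen (fun u => complex.Re (Kmx (kappa u) (tau u) k' l')) /\
    poly_alg gen (fun u => complex.Im (Kmx (kappa u) (tau u) k' l')).
  move: k' l'; apply: ord3_ind; apply: ord3_ind; split;
    under eq_fun do rewrite mxE /=;
    do ?[exact: poly_alg_cst|exact: gen_kappa|exact: gen_tau|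
         by apply: poly_alg_mul => //; exact: poly_alg_cst].
have [[a00 b00] [a10 b10] [a20 b20]] := And3 (cK i0 l) (cK i1 l) (cK i2 l).
by split; do ?[apply: poly_alg_add|apply: poly_alg_opp|apply: poly_alg_mul].
Qed.

Let gen_smooth f : poly_alg gen f -> smooth setT f.
Proof.
apply: poly_alg_smooth => {}f [->|->|->|[k [l [->|->]]]].
- by exists dtau => // t; have [] := twist t.
- exists (fun t => tau t * tau t
    + - (9 * c.1 * ((tau t)^-1 * (tau t)^-1) * (1 + - (c.1 * (tau t)^-1)))).
    do ?[apply: poly_alg_add|apply: poly_alg_opp|apply: poly_alg_mul];
      by [|exact: poly_alg_cst].
  move=> t; have [tau0 _ ] := twist t; move/is_derive_eq; apply.
  by rewrite expr2; field.
- exists (fun t => - ((tau t)^-1 * (tau t)^-1) * dtau t).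
    by apply: poly_alg_mul => //; apply: poly_alg_opp; apply: poly_alg_mul.
  move=> t; have [tau0 td _] := twist t.
  apply: is_derive_eq (is_derive_inv tau0 td) _.
  by rewrite -exprVn expr2.
- have [Gre _] := polyK k l; eexists; first exact: Gre.
  by move=> t; have [] := Fd t k l.
- have [_ Gim] := polyK k l; eexists; first exact: Gim.
  by move=> t; have [] := Fd t k l.
Qed.

Let kappad (s : R) : is_derive s 1 kappa (- 2 * c.1 * dtau s / tau s ^+ 3).
Proof.
have [tau0 td _] := twist s.
have tt0 : tau s ^+ 2 != 0 by rewrite expf_neq0.
have := is_derive_mul (is_derive_cst c.1 s (1 : R)) 
  (is_derive_inv (f := fun u => tau u ^+ 2) tt0 (is_derive_sqr td)).
by move/is_derive_eq; apply; field.
Qed.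

Let herm_frame k l s : herm (col k (F s)) (col l (F s)) = hmx R k l.
Proof. by rewrite herm_col; have [_ ->] := FG s. Qed.

Let wdetF s : wdet (fun u => col 0 (F u)) s = -1.
Proof. by have [_ ->] := wdet_frame Fd kappad; have [-> _] := FG s. Qed.

Let dF0 s : deriv_mx (fun u => col 0 (F u)) s =
  (0 +i* kappa s) *: col i0 (F s) + col i2 (F s).
Proof. by have [-> _] := wdet_frame Fd kappad. Qed.

Let o30 : 0 = i0 :> 'I_3. Proof. exact/val_inj. Qed.

(** F1 is null, so only the F3 part of F1' pairs with it. The value i makes the strain equal to 1
    and the contact form positive, and it excludes F1 = 0. *)
Let herm_dF0 s : herm (col 0 (F s)) (deriv_mx (fun u => col 0 (F u)) s) = 'i%C.
Proof. by rewrite dF0 o30 herm_add herm_scale !herm_frame !mxE /= mulr0 add0r. Qed.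

Let herm00 s : herm (col 0 (F s)) (col 0 (F s)) = 0.
Proof. by rewrite o30 herm_frame mxE. Qed.

Let F0_neq0 s : col 0 (F s) != 0.
Proof.
apply/eqP => F0; have := herm_dF0 s; rewrite F0 /herm.
have -> : ctr (0 : 'cV[R[i]]_3) = 0.
  by apply/matrixP => k l; rewrite !mxE /= oppr0.
rewrite !mul0mx mxE => /eqP; rewrite eq_complex /= => /andP[_].
by rewrite eq_sym oner_eq0.
Qed.

Let null_F : null_lift setT (fun s => cline (col 0 (F s))) (fun s => col 0 (F s)).
Proof.
split; last by move=> s _; split.
move=> k l; split; under eq_fun do rewrite mxE; exact: gen_smooth.
Qed.

(** Serves twice: for the explicit curve, and for the translate of it that extends a given critical
    curve. *)
Lemma critical_of_frame :
  critical setT (fun s => cline (col 0 (F s))) F kappa tau.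
Proof.
split.
- split; first by split; [exact: openT|by []|exists 0].
  exists (fun s => col 0 (F s)) => // s _; split.
    (* A derivative proportional to the null vector F1 would pair to 0 with it, not to i. *)
    move=> [a e]; have := herm_dF0 s; rewrite e herm_scale herm00 mulr0 => /eqP.
    by rewrite eq_sym eq_complex /= oner_eq0 andbF.
  rewrite /contact herm_dF0 divr_gt0 ?ctr_mul_gt0//.
  by rewrite (_ : - 'i%C * 'i%C = 1) ?ltr01//; apply: complex_eq => /=; ring.
- by exists (fun s => col 0 (F s)) => // s _; rewrite wdetF oppr_eq0 oner_eq0.
- exists (fun s => col 0 (F s)); first by split=> // s _; exact: wdetF.
  by move=> s _; rewrite /strain herm_dF0 divff// eq_complex /= oner_eq0 andbF.
- split.
  + by move=> k l; split; apply: gen_smooth.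
  + exact: gen_smooth.
  + exact: gen_smooth.
  + by split=> // s _; exact: wdetF.
  + by move=> s _; split; rewrite // (deriv_mxE (Fd s)) mulKmx// inG_unit.
- move=> s _; have [tau0 td tdd] := twist s.
  rewrite (is_derive_derive1 td) (is_derive_derive1 (kappad s)).
  have -> : derive1 tau = dtau.
    by apply/funext => u; have [_ ud _] := twist u; exact: is_derive_derive1.
  rewrite (is_derive_derive1 tdd) /kappa; split; field.
  all: by rewrite ?tau0.
Qed.

End CriticalOfFrame.
(** * The modular polynomials *)

Section Polynomials.
Variable R : realType.
Implicit Types (c : R * R) (x : R).

Lemma increasing3_eq (e1 e2 e3 f1 f2 f3 : R) :
  e1 < e2 -> e2 < e3 -> f1 < f2 -> f2 < f3 ->
  [\/ f1 = e1, f1 = e2 | f1 = e3] -> [\/ f2 = e1, f2 = e2 | f2 = e3] ->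
  [\/ f3 = e1, f3 = e2 | f3 = e3] -> [/\ f1 = e1, f2 = e2 & f3 = e3].
Proof.
move=> e12 e23 + + h1 h2 h3.
by case: h1 => ->; case: h2 => ->; case: h3 => -> f12 f23; split=> //; exfalso; lra.
Qed.

Lemma horner_Ppoly c x : (Ppoly c).[x] =
  x ^+ 5 + 3 / 2 * c.2 * x ^+ 2 + 27 * c.1 * x - 27 / 2 * c.1 ^+ 2.
Proof. by rewrite /Ppoly !hornerE. Qed.

Lemma horner_Qpoly c x : (Qpoly c).[x] = x ^+ 3 + 6 * c.1 * x + (27 + 3 * c.2).
Proof. by rewrite /Qpoly !hornerE. Qed.

Lemma Ppoly_Qpoly c x : 54 * (Ppoly c).[x] =
  27 * x ^+ 2 * (Qpoly c).[x ^+ 2 / 3] - (x ^+ 4 - 27 * x + 27 * c.1) ^+ 2.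
Proof. by rewrite horner_Ppoly horner_Qpoly; field. Qed.

(* By [Ppoly_Qpoly] the two conditions on [x] say that [x] is a root of [P] and
   [x ^+ 2 / 3] a root of [Q]. *)
Lemma Delta2_eq0 c x : c.1 != 0 -> x ^+ 4 - 27 * x + 27 * c.1 = 0 ->
  (18 + c.2) * x ^+ 2 = 9 * c.1 ^+ 2 -> Delta2 c = 0.
Proof.
move=> c0 x4 dx2; set d := 18 + c.2 in dx2.
(* Squaring the second relation brings in [x ^+ 4], which the first one makes affine in [x]; this
   determines [d ^+ 2 * x]. *)
have dx : d ^+ 2 * x = d ^+ 2 * c.1 + 3 * c.1 ^+ 4.
  have : d ^+ 2 * x ^+ 4 = (9 * c.1 ^+ 2) ^+ 2 by rewrite -dx2; ring.
  have -> : x ^+ 4 = 27 * x - 27 * c.1 by apply/eqP; rewrite -subr_eq0 -x4; apply/eqP; ring.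
  lra.
(* [Delta2 c] is [(d ^+ 2 + 3 * c.1 ^+ 3) ^+ 2 - 9 * d ^+ 3], which appears, times [c.1 ^+ 2], on
   comparing the two expressions of [d ^+ 4 * x ^+ 2]. *)
apply: (mulfI (expf_neq0 2 c0)); rewrite mulr0.
have : d ^+ 3 * (d * x ^+ 2) = (d ^+ 2 * x) ^+ 2 by ring.
rewrite dx dx2 /Delta2 /d; lra.
Qed.

Lemma B1_c1_lt0 c : B1 c -> c.1 < 0.
Proof.
move=> [D1 _]; rewrite ltNge; apply/negP => c1; move: D1; rewrite /Delta1.
have : 0 <= c.1 ^+ 3 by rewrite exprn_ge0.
have : 0 <= (9 + c.2) ^+ 2 by rewrite sqr_ge0.
lra.
Qed.

Variables (c : R * R) (e1 e2 e3 : R).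
Hypotheses (hB : B1 c) (he12 : e1 < e2) (he23 : e2 < e3).
Hypothesis he : forall x, root (Ppoly c) x = (x \in [:: e1; e2; e3]).

(** P has real values, so its two non-real roots are conjugate, and [a], [b] are their real and
    imaginary parts up to the sign of [b]. The real roots supplied by [B1] are the given ones
    because both triples are increasing. *)
Lemma B1_factorization : exists a b, b != 0 /\ forall x,
  (Ppoly c).[x] = (x - e1) * (x - e2) * (x - e3) * ((x - a) ^+ 2 + b ^+ 2).
Proof.
have e12 := he12; have e23 := he23.
have [_ [f1 [f2 [f3 [w1 [w2 [f12 f23 w1i w2i PE]]]]]]] := hB.
have PxE (x : R) : ((Ppoly c).[x])%:C =
    ((x - f1) * (x - f2) * (x - f3))%:C * ((x%:C - w1) * (x%:C - w2)).
  have := congr1 (fun p => p.[x%:C]) PE.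
  rewrite horner_map /= => ->; rewrite !big_cons big_nil !hornerE.
  by rewrite !rmorphM !rmorphB /=; ring.
have fe (f : R) : (f - f1) * (f - f2) * (f - f3) = 0 ->
    [\/ f = e1, f = e2 | f = e3].
  move=> f0; suff : f \in [:: e1; e2; e3].
    by rewrite !inE => /or3P[]/eqP ->; [constructor 1|constructor 2|constructor 3].
  by rewrite -he; apply/rootP; have := PxE f; rewrite f0 mul0r => -[].
have [ef1 ef2 ef3] : [/\ f1 = e1, f2 = e2 & f3 = e3].
  have := fe f1; have := fe f2; have := fe f3; rewrite !subrr !(mul0r, mulr0).
  move=> /(_ erefl)h3 /(_ erefl)h2 /(_ erefl)h1; exact: increasing3_eq.
subst f1 f2 f3.
case: w1 w2 w1i w2i PE PxE => [u1 v1] [u2 v2] /= v10 v20 _ PxE.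
have re (x : R) : (Ppoly c).[x] = (x - e1) * (x - e2) * (x - e3) *
    ((x - u1) * (x - u2) - v1 * v2).
  by have /(congr1 (@complex.Re R)) /= := PxE x => ->; ring.
have im (x : R) : (x - e1) * (x - e2) * (x - e3) * ((x - u1) * v2 + (x - u2) * v1) = 0.
  by have /(congr1 (@complex.Im R)) /= := PxE x; lra.
have imx (x : R) : e3 < x -> (x - u1) * v2 + (x - u2) * v1 = 0.
  move=> ex; have /eqP := im x; rewrite !mulf_eq0 !subr_eq0.
  by move=> /orP[/orP[/orP[]|]|]/eqP // x0; lra.
(* The imaginary part of the quadratic factor is affine in [x]; two points beyond [e3] suffice to
   annihilate it. *)
have h1 : (e3 + 1 - u1) * v2 + (e3 + 1 - u2) * v1 = 0 by apply: imx; lra.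
have h2 : (e3 + 2 - u1) * v2 + (e3 + 2 - u2) * v1 = 0 by apply: imx; lra.
have v12 : v2 = - v1 by lra.
have /eqP : (u1 - u2) * v1 = 0 by rewrite v12 in h1; lra.
rewrite mulf_eq0 (negbTE v10) orbF subr_eq0 => /eqP u12.
by exists u1, v1; split=> // x; rewrite re v12 u12; ring.
Qed.

Lemma B1_root : [/\ (Ppoly c).[e1] = 0, (Ppoly c).[e2] = 0 & (Ppoly c).[e3] = 0].
Proof. by split; apply/rootP; rewrite he !inE eqxx ?orbT. Qed.

Lemma B1_e2_lt0 : e2 < 0.
Proof.
have e12 := he12; have e23 := he23.
have [a [b [b0 PE]]] := B1_factorization; have c0 := B1_c1_lt0 hB.
have b2 : 0 < b ^+ 2 by rewrite lt_def sqr_ge0 sqrf_eq0 b0.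
rewrite ltNge le_eqVlt; apply/negP => /orP[/eqP e20|e20].
  have [_ + _] := B1_root; rewrite -e20 horner_Ppoly.
  have : 0 < c.1 ^+ 2 by rewrite lt_def sqr_ge0 sqrf_eq0 lt_eqF.
  by rewrite !expr0n /=; lra.
have [P1 P2 P3] := B1_root.
(* On the positive half line [P x / x ^+ 2] is increasing. *)
suff: (Ppoly c).[e2] * e3 ^+ 2 - (Ppoly c).[e3] * e2 ^+ 2 < 0.
  by rewrite P2 P3 !mul0r subr0 ltxx.
rewrite !horner_Ppoly.
have -> : (e2 ^+ 5 + 3 / 2 * c.2 * e2 ^+ 2 + 27 * c.1 * e2 - 27 / 2 * c.1 ^+ 2) * e3 ^+ 2 -
  (e3 ^+ 5 + 3 / 2 * c.2 * e3 ^+ 2 + 27 * c.1 * e3 - 27 / 2 * c.1 ^+ 2) * e2 ^+ 2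
  = (e3 - e2) * ((27 * c.1) * (e2 * e3) - 27 / 2 * c.1 ^+ 2 * (e2 + e3)
     - (e2 * e3) ^+ 2 * (e2 ^+ 2 + e2 * e3 + e3 ^+ 2)) by field.
have e30 := lt_trans e20 he23.
rewrite pmulr_rlt0 ?subr_gt0//.
have h1 : c.1 * (e2 * e3) < 0 by rewrite nmulr_rlt0// mulr_gt0.
have h2 : 0 <= c.1 ^+ 2 * (e2 + e3) by rewrite mulr_ge0 ?sqr_ge0// addr_ge0 ?ltW.
have h3 : 0 <= (e2 * e3) ^+ 2 * (e2 ^+ 2 + e2 * e3 + e3 ^+ 2).
  by rewrite mulr_ge0 ?sqr_ge0// !addr_ge0 ?sqr_ge0// mulr_ge0 ?ltW.
lra.
Qed.

(** Otherwise P(0) = -27/2 c1^2 < 0 would be a product of nonnegative factors. *)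
Lemma B1_e3_gt0 : 0 < e3.
Proof.
have e12 := he12; have e23 := he23.
have [a [b [b0 PE]]] := B1_factorization; have c0 := B1_c1_lt0 hB.
have := PE 0; rewrite horner_Ppoly !expr0n /= !mulr0 !add0r => h.
have e20 := B1_e2_lt0.
have q0 : 0 < (- a) ^+ 2 + b ^+ 2 by rewrite ltr_wpDl ?sqr_ge0// lt_def sqr_ge0 sqrf_eq0 b0.
have : 0 < c.1 ^+ 2 by rewrite lt_def sqr_ge0 sqrf_eq0 lt_eqF.
have p12 : 0 < - e1 * - e2 by rewrite mulr_gt0// oppr_gt0//; lra.
rewrite ltNge; move=> c2; apply/negP => e30.
have : 0 <= - e1 * - e2 * - e3 * ((- a) ^+ 2 + b ^+ 2).
  by apply: mulr_ge0; [apply: mulr_ge0; [exact: ltW|lra]|exact: ltW].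
lra.
Qed.

Lemma Ppoly_ge0 x : 0 <= (Ppoly c).[x] -> e1 <= x <= e2 \/ e3 <= x.
Proof.
have [a [b [b0 PE]]] := B1_factorization.
have q0 : 0 < (x - a) ^+ 2 + b ^+ 2 by rewrite ltr_wpDl ?sqr_ge0// lt_def sqr_ge0 sqrf_eq0 b0.
rewrite PE pmulr_lge0// => h.
have [x3|x3] := leP e3 x; [by right|left].
have {h} : (x - e1) * (x - e2) <= 0 by rewrite -(nmulr_lge0 _ (x := x - e3)) ?subr_lt0.
have [x1|x1] := ltP x e1; first by rewrite leNgt nmulr_rgt0 subr_lt0 ?x1// (lt_trans x1).
have [x2|x2] := leP x e2 => //.
by rewrite leNgt mulr_gt0// subr_gt0// (lt_trans he12).
Qed.

Lemma Ppoly_ge0_itv x : e1 <= x <= e2 -> 0 <= (Ppoly c).[x].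
Proof.
have [a [b [b0 PE]]] := B1_factorization => /andP[x1 x2]; rewrite PE mulr_ge0//.
  by rewrite -mulrA mulr_ge0 ?subr_ge0// mulr_le0// subr_le0// (le_trans x2)// ltW.
by rewrite addr_ge0 ?sqr_ge0.
Qed.

Lemma Ppoly_lt0_itv x : e2 < x < e3 -> (Ppoly c).[x] < 0.
Proof.
have e12 := he12; have e23 := he23.
move=> /andP[x2 x3]; rewrite ltNge; apply/negP => /Ppoly_ge0[/andP[_]|]; lra.
Qed.

(** [e2] is a simple root. The factorization is known for values only, so the two formal derivatives
    are compared through the derivative of the polynomial function. *)
Lemma deriv_Ppoly_e2 : (Ppoly c)^`().[e2] != 0.
Proof.
have [a [b [b0 PE]]] := B1_factorization.
have [r rE] : exists r : {poly R}, forall x,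
    r.[x] = (x - e1) * (x - e3) * ((x - a) ^+ 2 + b ^+ 2).
  exists (('X - e1%:P) * ('X - e3%:P) * (('X - a%:P) ^+ 2 + (b ^+ 2)%:P)) => x.
  by rewrite !hornerE.
have d1 : is_derive e2 1 (fun x => (Ppoly c).[x]) (Ppoly c)^`().[e2].
  exact: is_derive_poly.
have d2 : is_derive e2 1 (fun x => (Ppoly c).[x]) (('X - e2%:P) * r)^`().[e2].
  have -> : (fun x => (Ppoly c).[x]) = (fun x => (('X - e2%:P) * r).[x]).
    by apply/funext => x; rewrite PE hornerM hornerXsubC rE; ring.
  exact: is_derive_poly.
rewrite -(is_derive_derive1 d1) (is_derive_derive1 d2).
rewrite derivM derivXsubC mul1r hornerD hornerM hornerXsubC subrr mul0r addr0 rE.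
rewrite !mulf_neq0// ?subr_eq0 ?(gt_eqF he12) ?(lt_eqF he23)//.
by rewrite gt_eqF// ltr_wpDl ?sqr_ge0// lt_def sqr_ge0 sqrf_eq0 b0.
Qed.

Variables (l1 l2 l3 : R).
Hypotheses (hl12 : l1 < l2) (hl23 : l2 < l3).
Hypothesis hl : forall x, root (Qpoly c) x = (x \in [:: l1; l2; l3]).

(** Divided differences of Q at two pairs of roots give quadratic relations, and the divided
    difference of these gives the vanishing of the sum of the roots. *)
Lemma Qpoly_vieta : [/\ l1 = - (l2 + l3), 6 * c.1 = l1 * l2 + l1 * l3 + l2 * l3 &
  27 + 3 * c.2 = - (l1 * l2 * l3)].
Proof.
have l12 := hl12; have l23 := hl23.
have Q1 : (Qpoly c).[l1] = 0 by apply/rootP; rewrite hl !inE eqxx.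
have Q2 : (Qpoly c).[l2] = 0 by apply/rootP; rewrite hl !inE eqxx orbT.
have Q3 : (Qpoly c).[l3] = 0 by apply/rootP; rewrite hl !inE eqxx !orbT.
move: Q1 Q2 Q3; rewrite !horner_Qpoly => Q1 Q2 Q3.
have s12 : l1 ^+ 2 + l1 * l2 + l2 ^+ 2 + 6 * c.1 = 0.
  have d : l1 - l2 != 0 by rewrite subr_eq0 lt_eqF.
  by apply: (mulfI d); lra.
have s23 : l2 ^+ 2 + l2 * l3 + l3 ^+ 2 + 6 * c.1 = 0.
  have d : l2 - l3 != 0 by rewrite subr_eq0 lt_eqF.
  by apply: (mulfI d); lra.
have s : l1 + l2 + l3 = 0.
  have d : l1 - l3 != 0 by rewrite subr_eq0 lt_eqF// (lt_trans hl12).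
  by apply: (mulfI d); lra.
have l1E : l1 = - (l2 + l3) by lra.
split=> //; first by rewrite l1E; lra.
have := congr1 (fun z => l1 * z) s23; rewrite l1E; rewrite l1E in Q1; lra.
Qed.

Lemma Qpoly_factorization x : (Qpoly c).[x] = (x - l1) * (x - l2) * (x - l3).
Proof.
have [l1E c1E c2E] := Qpoly_vieta.
by rewrite horner_Qpoly c1E c2E l1E; ring.
Qed.

Lemma Qpoly_l1_lt0 : l1 < 0.
Proof.
have l12 := hl12; have l23 := hl23. have [l1E _ _] := Qpoly_vieta; lra. Qed. 
Hypothesis hgen : general c.

Lemma Qpoly_gt0 x : e1 <= x <= e2 -> 0 < (Qpoly c).[x ^+ 2 / 3].
Proof.
move=> xe; have P0 := Ppoly_ge0_itv xe; have := Ppoly_Qpoly c x.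
have x0 : x < 0 by case/andP: xe => _ /le_lt_trans; apply; exact: B1_e2_lt0.
have x2 : 0 < x ^+ 2 by rewrite lt_def sqr_ge0 sqrf_eq0 lt_eqF.
set q := x ^+ 4 - _ + _ => PQ.
have q2 : 0 <= q ^+ 2 by rewrite sqr_ge0.
have Q0 : 0 <= (Qpoly c).[x ^+ 2 / 3].
  have p0 : 0 < 27 * x ^+ 2 by lra.
  rewrite -(pmulr_rge0 _ p0).
  by rewrite -[X in 0 <= X](subrK (q ^+ 2)) -PQ addr_ge0// mulr_ge0.
(* If Q vanishes, the identity reads 54 P(x) = - q^2 with P(x) nonnegative, so both P(x) and [q]
   vanish. *)
rewrite lt_neqAle Q0 andbT eq_sym; apply/eqP => Qx.
move: PQ; rewrite Qx mulr0 sub0r => PQ.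
have {}q2 : q ^+ 2 = 0 by lra.
have Px : (Ppoly c).[x] = 0 by lra.
have {q2} q0 : q = 0 by apply/eqP; rewrite -sqrf_eq0 q2.
have c1 : c.1 != 0 by rewrite lt_eqF// B1_c1_lt0.
suff D2 : Delta2 c = 0 by move: hgen; rewrite /general D2 mulr0 eqxx.
apply: (Delta2_eq0 (x := x)) => //; move: Px q0; rewrite horner_Ppoly /q => Px q0.
(* Reducing P(x) = 0 by [q = 0] leaves exactly the quadratic relation required by [Delta2_eq0]. *)
have e : x ^+ 5 = x * (27 * x - 27 * c.1).
  have := congr1 (fun z => x * z) q0; lra.
rewrite e in Px; lra.
Qed.

(** [x ^+ 2 / 3] lies above the negative root [l1] of Q, and Q is positive there. Consequently no
    radicand of the explicit curve vanishes on the oval. *)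
Lemma sqr_twist_dichotomy x : e1 <= x <= e2 ->
  3 * l1 < x ^+ 2 /\ (x ^+ 2 < 3 * l2 \/ 3 * l3 < x ^+ 2).
Proof.
move=> /Qpoly_gt0; rewrite Qpoly_factorization => Q0; have l10 := Qpoly_l1_lt0.
have x2 : 0 <= x ^+ 2 by rewrite sqr_ge0.
split; first lra.
have y1 : 0 < x ^+ 2 / 3 - l1 by lra.
move: Q0; rewrite -mulrA pmulr_rgt0// => Q0.
have [x3|x3] := ltP (3 * l3) (x ^+ 2); [by right|left].
have : x ^+ 2 / 3 - l3 <= 0 by lra.
rewrite le_eqVlt => /orP[/eqP x3'|x3']; first by rewrite x3' mulr0 ltxx in Q0.
by move: Q0; rewrite nmulr_lgt0//; lra.
Qed.

End Polynomials.
(** * The twist equation *)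

Section TwistEquation.
Variable R : realType.
Implicit Types (c : R * R) (J : set R) (tau dtau : R -> R).

Lemma twist_ode_energy c J tau dtau s0 : is_interval J -> J s0 ->
  (forall s, J s -> twist_ode c tau dtau s) ->
  3 / 2 * tau s0 ^+ 2 * dtau s0 ^+ 2 = (Ppoly c).[tau s0] ->
  forall s, J s -> 3 / 2 * tau s ^+ 2 * dtau s ^+ 2 = (Ppoly c).[tau s].
Proof.
move=> iJ Js0 ode e0 s Js.
(* The conserved quantity that defines [c.2], with [c.1 / tau ^+ 2] in place of the bending. *)
pose W u := - 18 * c.1 * (tau u)^-1 + 9 * c.1 ^+ 2 * (tau u)^-1 ^+ 2
  + - (2 / 3 * (tau u ^+ 2 * tau u)) + dtau u ^+ 2.
have PW u : J u -> 3 / 2 * tau u ^+ 2 * dtau u ^+ 2 - (Ppoly c).[tau u] =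
    3 / 2 * tau u ^+ 2 * (W u - c.2).
  by move=> /ode[t0 _ _]; rewrite horner_Ppoly /W; field.
have Wd u : J u -> is_derive u 1 W 0.
  move=> /ode[t0 td tdd].
  have tVd := is_derive_inv t0 td.
  have cd (a : R) : is_derive u 1 (fun=> a) 0 := is_derive_cst a u 1.
  have d1 := is_derive_mul (cd (- 18 * c.1)) tVd.
  have d2 := is_derive_mul (cd (9 * c.1 ^+ 2)) (is_derive_sqr tVd).
  have d3 := is_derive_opp (is_derive_mul (cd (2 / 3)) (is_derive_mul (is_derive_sqr td) td)).
  have := is_derive_add (is_derive_add (is_derive_add d1 d2) d3) (is_derive_sqr tdd).
  by move/is_derive_eq; apply; field.
have W0 : W s0 = c.2.
  have [t0 _ _] := ode s0 Js0; have /eqP := PW s0 Js0.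
  rewrite e0 subrr eq_sym mulf_eq0 (negbTE (_ : 3 / 2 * _ != 0)) /=.
    by rewrite subr_eq0 => /eqP.
  by rewrite mulf_neq0 ?expf_neq0.
apply/eqP; rewrite -subr_eq0 PW// -(derive0_const iJ Wd Js0 Js) W0.
by rewrite subrr mulr0.
Qed.

(** The difference of the two forces is divisible by [x - y]; the cofactor is a polynomial in [x],
    [y] and their inverses, bounded term by term. *)
Lemma twist_force_lipschitz (a k m x y : R) : x != 0 -> y != 0 ->
  `|x| <= m -> `|y| <= m -> `|x^-1| <= k -> `|y^-1| <= k ->
  `|(x ^+ 2 - 9 * a / x ^+ 2 * (1 - a / x)) -
    (y ^+ 2 - 9 * a / y ^+ 2 * (1 - a / y))|
  <= (2 * m + 18 * `|a| * k ^+ 3 + 27 * a ^+ 2 * k ^+ 4) * `|x - y|.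
Proof.
move=> x0 y0 xm ym; set u := x^-1; set v := y^-1 => uk vk.
have -> : (x ^+ 2 - 9 * a / x ^+ 2 * (1 - a / x)) -
    (y ^+ 2 - 9 * a / y ^+ 2 * (1 - a / y)) =
  (x + y + 9 * a * (u + v) * u * v
     - 9 * a ^+ 2 * (u ^+ 2 + u * v + v ^+ 2) * u * v) * (x - y).
  by rewrite /u /v; field; rewrite x0 y0.
rewrite normrM ler_wpM2r//.
have m0 : 0 <= m by apply: le_trans xm.
have k0 : 0 <= k by apply: le_trans uk.
have uvk : `|u| * `|v| <= k * k by apply: ler_pM.
have uuk : `|u| * `|u| <= k * k by apply: ler_pM.
have vvk : `|v| * `|v| <= k * k by apply: ler_pM.
have b1 : `|x + y| <= m + m by apply: (le_trans (ler_normD _ _)); apply: lerD.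
have b2 : `|9 * a * (u + v) * u * v| <= 18 * `|a| * k ^+ 3.
  rewrite -mulrA normrM normrM (normrM 9) ger0_norm// -mulrA normrM.
  have -> : 18 * `|a| * k ^+ 3 = 9 * `|a| * ((k + k) * (k * k)) by ring.
  rewrite -mulrA -mulrA ler_wpM2l// ler_wpM2l//.
  by apply: ler_pM => //; apply: (le_trans (ler_normD _ _)); apply: lerD.
have b3 : `|9 * a ^+ 2 * (u ^+ 2 + u * v + v ^+ 2) * u * v| <= 27 * a ^+ 2 * k ^+ 4.
  rewrite -mulrA normrM normrM (normrM 9) ger0_norm// normrX -mulrA normrM.
  have -> : 27 * a ^+ 2 * k ^+ 4 = 9 * a ^+ 2 * ((k * k + k * k + k * k) * (k * k)) by ring.
  rewrite -normrX (ger0_norm (sqr_ge0 a)) -mulrA -mulrA ler_wpM2l// ler_wpM2l ?sqr_ge0//.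
  apply: ler_pM => //; apply: (le_trans (ler_normD _ _)).
  rewrite normrX expr2 lerD//; apply: (le_trans (ler_normD _ _)).
  by rewrite !normrM lerD.
apply: (le_trans (ler_normB _ _)); apply: lerD => //.
apply: (le_trans (ler_normD _ _)); apply: lerD => //.
by rewrite mulr_natl mulr2n.
Qed.

(** The force is singular at 0; confining both solutions to a segment of negative numbers makes it
    Lipschitz, with the constant [L]. Gronwall's lemma then applies to the squared distance [E] in
    the phase plane. *)
Lemma twist_ode_unique c J (a b : R) tau1 dtau1 tau2 dtau2 s0 :
  a <= b -> b < 0 -> is_interval J -> J s0 ->
  (forall s, J s -> twist_ode c tau1 dtau1 s /\ a <= tau1 s <= b) ->
  (forall s, J s -> twist_ode c tau2 dtau2 s /\ a <= tau2 s <= b) ->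
  tau1 s0 = tau2 s0 -> dtau1 s0 = dtau2 s0 ->
  forall s, J s -> tau1 s = tau2 s.
Proof.
move=> ab b0 iJ Js0 ode1 ode2 e0 de0.
pose f x : R := x ^+ 2 - 9 * c.1 / x ^+ 2 * (1 - c.1 / x).
have bnd x : a <= x <= b -> [/\ x != 0, `|x| <= - a & `|x^-1| <= (- b)^-1].
  move=> /andP[ax xb]; have x0 : x < 0 by rewrite (le_lt_trans xb).
  split; first by rewrite lt_eqF.
    by rewrite ltr0_norm// lerN2.
  by rewrite normfV ltr0_norm// lef_pV2 ?lerN2// posrE oppr_gt0.
pose L := 2 * (- a) + 18 * `|c.1| * (- b)^-1 ^+ 3 + 27 * c.1 ^+ 2 * (- b)^-1 ^+ 4.
pose E s := (tau1 s - tau2 s) ^+ 2 + (dtau1 s - dtau2 s) ^+ 2.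
pose dE s := 2 * (tau1 s - tau2 s) * (dtau1 s - dtau2 s) +
  2 * (dtau1 s - dtau2 s) * (f (tau1 s) - f (tau2 s)).
suff E0 s : J s -> E s = 0.
  move=> s Js; apply/eqP; rewrite -subr_eq0 -sqrf_eq0.
  have := E0 s Js; rewrite /E => /eqP; rewrite paddr_eq0 ?sqr_ge0//.
  by case/andP.
(* With [x], [y] the differences of position and velocity, [dE] is at most 2 (1 + L) |x| |y|, hence
   at most (1 + L) (x^2 + y^2). *)
apply: (gronwall0 (M := 1 + L) (dE := dE) iJ Js0).
- by rewrite /E e0 de0 !subrr expr0n addr0.
- move=> u Ju; have [[_ t1 dt1] _] := ode1 u Ju; have [[_ t2 dt2] _] := ode2 u Ju.
  apply: is_derive_add; apply: is_derive_sqr;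
    by apply: is_derive_add => //; exact: is_derive_opp.
- move=> u Ju; rewrite /E /dE.
  have [_ /bnd[x0 xm xk]] := ode1 u Ju; have [_ /bnd[y0 ym yk]] := ode2 u Ju.
  have fL : `|f (tau1 u) - f (tau2 u)| <= L * `|tau1 u - tau2 u|.
    exact: twist_force_lipschitz.
  have L0 : 0 <= L.
    have ma : 0 <= - a by exact: le_trans xm.
    have mb : 0 <= (- b)^-1 by exact: le_trans xk.
    have h3 : 0 <= (- b)^-1 ^+ 3 by exact: exprn_ge0.
    have h4 : 0 <= (- b)^-1 ^+ 4 by exact: exprn_ge0.
    have h5 : 0 <= `|c.1| * (- b)^-1 ^+ 3 by rewrite mulr_ge0.
    have h6 : 0 <= c.1 ^+ 2 * (- b)^-1 ^+ 4 by rewrite mulr_ge0 ?sqr_ge0.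
    rewrite /L; lra.
  set x := tau1 u - _ in fL *; set y := dtau1 u - _; set g := _ - _ in fL *.
  split; first by rewrite addr_ge0 ?sqr_ge0.
  apply: (le_trans (ler_normD _ _)); rewrite !normrM ger0_norm//.
  rewrite -(real_normK (num_real x)) -(real_normK (num_real y)).
  have yg : `|y| * `|g| <= L * (`|x| * `|y|).
    by rewrite mulrA [leRHS]mulrC ler_wpM2l.
  have xy : 2 * (`|x| * `|y|) <= `|x| ^+ 2 + `|y| ^+ 2.
    by have := sqr_ge0 (`|x| - `|y|); lra.
  have := ler_wpM2l (addr_ge0 ler01 L0) xy.
  lra.
Qed.

End TwistEquation.
(** * The compact component of the quintic *)

Section Oval.
Variables (R : realType) (c : R * R) (e1 e2 e3 : R).
Hypotheses (hB : B1 c) (he12 : e1 < e2) (he23 : e2 < e3).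
Hypothesis he : forall x, root (Ppoly c) x = (x \in [:: e1; e2; e3]).

(** For [sg] equal to 1 or -1, the two branches of the quintic. As [Num.sqrt] is 0 on negative
    numbers, [arc] is continuous on the whole line, although it lies on the quintic only where P is
    nonnegative. *)
Let arc (sg x : R) : R * R := (x, sg * Num.sqrt (Ppoly c).[x]).

Let arc_continuous sg : continuous (arc sg).
Proof.
move=> x; apply: (@cvg_pair _ _ _ (nbhs x) (nbhs x) (nbhs (arc sg x).2) _ _ _ id).
  exact: cvg_id.
apply: cvgM; first exact: cvg_cst.
apply: (@continuous_comp _ _ _ (fun x => (Ppoly c).[x]) Num.sqrt).
  exact: is_derive_continuous (is_derive_poly (Ppoly c) x).
exact: sqrt_continuous.
Qed.

Let arc_quintic sg x : sg ^+ 2 = 1 -> 0 <= (Ppoly c).[x] -> quintic c (arc sg x).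
Proof. by move=> sg1 P0; rewrite /quintic /= exprMn sg1 mul1r sqr_sqrtr. Qed.

Let arc_of p : quintic c p -> exists2 sg : R, sg ^+ 2 = 1 & p = arc sg p.1.
Proof.
case: p => x y; rewrite /quintic /= => yP.
exists (if y < 0 then -1 else 1); first by case: ifP => _; rewrite ?sqrrN expr1n.
rewrite /arc /= -yP sqrtr_sqr; congr (_, _).
by case: (ltP y 0) => y0; [rewrite ltr0_norm// mulN1r opprK|rewrite ger0_norm// mul1r].
Qed.

Let arc_connected sg (I : set R) : is_interval I -> connected (arc sg @` I).
Proof.
move=> /connected_intervalP cI; apply: connected_continuous_connected => //.
exact/continuous_subspaceT/arc_continuous.
Qed.

Definition oval : set (R * R) := [set p | quintic c p /\ e1 <= p.1 <= e2].

Let Pe2 : (Ppoly c).[e2] = 0. Proof. by have [] := B1_root he. Qed.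

Let arc_e2 sg : arc sg e2 = (e2, 0).
Proof. by rewrite /arc Pe2 sqrtr0 mulr0. Qed.

Let oval_arcs : oval = arc 1 @` `[e1, e2] `|` arc (-1) @` `[e1, e2].
Proof.
have inI x : e1 <= x <= e2 -> `[e1, e2]%classic x by rewrite /= in_itv.
apply/seteqP; split=> p.
  move=> [/arc_of[sg sg1 ->] pe]; move/eqP: sg1; rewrite sqrf_eq1 => /orP[]/eqP ->.
  - by left; exists p.1 => //; exact: inI.
  - by right; exists p.1 => //; exact: inI.
by move=> [][x]; rewrite /= in_itv /= => xe <-; split => //; apply: arc_quintic;
  rewrite ?sqrrN ?expr1n// (Ppoly_ge0_itv hB he12 he23 he).
Qed.

Lemma oval_compact : compact oval.
Proof.
have carc sg : compact (arc sg @` `[e1, e2]).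
  apply: continuous_compact; last exact: segment_compact.
  exact/continuous_subspaceT/arc_continuous.
have -> : oval = \big[setU/set0]_(sg <- [:: 1; -1]) (arc sg @` `[e1, e2]).
  by rewrite !big_cons big_nil setU0 oval_arcs.
exact: bigsetU_compact.
Qed.

(** The first projection of the component is an interval and avoids the gap between [e2] and [e3],
    where P < 0; the midpoint is tested. Conversely the two arcs meet at (e2, 0), so their union is
    connected. *)
Lemma oval_component : connected_component (quintic c) (e2, 0) = oval.
Proof.
apply/seteqP; split.
- have cC := @component_connected _ (quintic c) (e2, 0 : R).
  have C0 : connected_component (quintic c) (e2, 0 : R) (e2, 0).
    by apply: connected_component_refl; rewrite /quintic /= Pe2 expr0n.
  have Cq : connected_component (quintic c) (e2, 0 : R) `<=` quintic c.
    exact: connected_component_sub.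
  move: cC C0 Cq; set C := connected_component _ _ => cC C0 Cq p Cp.
  have Qp := Cq p Cp; split=> //.
  have [//|p3] : e1 <= p.1 <= e2 \/ e3 <= p.1.
    by apply: (Ppoly_ge0 hB he12 he23 he); rewrite -Qp sqr_ge0.
  have : is_interval (fst @` C).
    apply/connected_intervalP; apply: connected_continuous_connected => //.
    by apply: continuous_subspaceT => x; exact: cvg_fst.
  move=> /(_ e2 p.1) itv.
  have [|||[x y] Cxy /= x0] := itv _ _ ((e2 + e3) / 2).
  + by exists (e2, 0).
  + by exists p.
  + by have e23 := he23; apply/andP; split; lra.
  have := Cq _ Cxy; rewrite /quintic /= x0 => y2.
  have : (Ppoly c).[(e2 + e3) / 2] < 0.
    by apply: (Ppoly_lt0_itv hB he12 he23 he); have e23 := he23; apply/andP; split; lra.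
  by rewrite -y2 ltNge sqr_ge0.
- have inI x : e1 <= x <= e2 -> `[e1, e2]%classic x by rewrite /= in_itv.
  apply: connected_component_max; [|by move=> ? []|].
  + by split; rewrite /quintic /= ?Pe2 ?expr0n// (ltW he12) lexx.
  + rewrite oval_arcs; apply: connectedU; last 2 first.
    * exact/arc_connected/interval_is_interval.
    * exact/arc_connected/interval_is_interval.
    exists (e2, 0); split; exists e2; rewrite ?arc_e2//; apply: inI;
      by rewrite lexx (ltW he12).
Qed.

(** A point with abscissa at least [e3] lies on an arc running to infinity, so its component is
    unbounded. Any other point is joined to (e2, 0) along its own arc. *)
Lemma compact_component_e2 p : quintic c p ->
  compact (connected_component (quintic c) p) ->
  connected_component (quintic c) p (e2, 0).
Proof.
move=> Qp cp; have [sg sg1 pE] := arc_of Qp.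
have sub (I : set R) : is_interval I -> I p.1 -> (forall x, I x -> 0 <= (Ppoly c).[x]) ->
    arc sg @` I `<=` connected_component (quintic c) p.
  move=> iI Ip IP; apply: connected_component_max.
  - by exists p.1.
  - by move=> _ [x Ix <-]; apply: arc_quintic => //; exact: IP.
  - exact: arc_connected.
have [/andP[p1 p2]|p3] : e1 <= p.1 <= e2 \/ e3 <= p.1.
  by apply: (Ppoly_ge0 hB he12 he23 he); rewrite -Qp sqr_ge0.
- apply: (sub `[p.1, e2]); first exact: interval_is_interval.
  + by rewrite /= in_itv /= lexx.
  + move=> x; rewrite /= in_itv /= => /andP[px xe2].
    by apply: (Ppoly_ge0_itv hB he12 he23 he); rewrite (le_trans p1).
  + by exists e2; rewrite ?arc_e2// /= in_itv /= lexx p2.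
- have sub3 : arc sg @` `[p.1, +oo[ `<=` connected_component (quintic c) p.
    apply: sub; first exact: interval_is_interval.
    + by rewrite /= in_itv /= lexx.
    + move=> x; rewrite /= in_itv /= andbT => px.
      have [a [b [b0 ->]]] := B1_factorization hB he12 he23 he.
      have e3x := le_trans p3 px; have e12 := he12; have e23 := he23.
      by do ![apply: mulr_ge0]; rewrite ?subr_ge0 ?addr_ge0 ?sqr_ge0//; lra.
  have : bounded_set (fst @` connected_component (quintic c) p).
    apply: compact_bounded; apply: continuous_compact => //.
    by apply: continuous_subspaceT => x; exact: cvg_fst.
  move=> [M [_ HM]]; pose x := Num.max p.1 (`|M| + 2).
  have : `|x| <= M + 1.
    apply: (HM (M + 1)); first by rewrite ltrDl.
    exists (arc sg x) => //; apply: sub3; exists x => //.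
    by rewrite /= in_itv /= andbT le_max lexx.
  have xM : `|M| + 2 <= x by rewrite le_max lexx orbT.
  by have := ler_norm x; have := ler_norm M; lra.
Qed.

End Oval.

(** * Solutions of the twist equation that start at the vertex of the oval *)

Section Twist.
Variables (R : realType) (c : R * R) (e1 e2 e3 : R).
Hypotheses (hB : B1 c) (he12 : e1 < e2) (he23 : e2 < e3).
Hypothesis he : forall x, root (Ppoly c) x = (x \in [:: e1; e2; e3]).

(** Energy conservation makes P nonnegative along the solution, and the twist, never zero, keeps the
    sign of [e2], which excludes the branch beyond [e3]. The interval [J] is arbitrary because the
    domain of a given critical curve is not known in advance. *)
Lemma twist_ode_range J tau dtau s0 : is_interval J -> J s0 ->
  (forall s, J s -> twist_ode c tau dtau s) -> tau s0 = e2 -> dtau s0 = 0 ->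
  forall s, J s -> 3 / 2 * tau s ^+ 2 * dtau s ^+ 2 = (Ppoly c).[tau s] /\
                   e1 <= tau s <= e2.
Proof.
move=> iJ Js0 ode t0 dt0 s Js.
have [_ Pe2 _] := B1_root he; have e20 := B1_e2_lt0 hB he12 he23 he.
have e30 := B1_e3_gt0 hB he12 he23 he.
have energy : 3 / 2 * tau s ^+ 2 * dtau s ^+ 2 = (Ppoly c).[tau s].
  by apply: (twist_ode_energy iJ Js0 ode) => //; rewrite t0 dt0 Pe2 expr0n mulr0.
split=> //.
have : Num.sg (tau s) = Num.sg (tau s0).
  apply: (continuous_nonvanishing_sg iJ _ _ Js Js0) => u /ode[] // _ td _.
  exact: is_derive_continuous td.
rewrite t0 (ltr0_sg e20) => /eqP; rewrite sgr_cp0 => ts.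
have [//|] : e1 <= tau s <= e2 \/ e3 <= tau s.
  apply: (Ppoly_ge0 hB he12 he23 he); rewrite -energy.
  by rewrite mulr_ge0 ?sqr_ge0// mulr_ge0 ?sqr_ge0.
by move=> /(lt_le_trans e30)/(lt_trans ts); rewrite ltxx.
Qed.

(* At a root of [P] the force is [P' / (3 x ^+ 2)]. *)
Lemma twist_force_e2 : e2 ^+ 2 - 9 * c.1 / e2 ^+ 2 * (1 - c.1 / e2) != 0.
Proof.
have e20 : e2 != 0 by rewrite lt_eqF// (B1_e2_lt0 hB he12 he23 he).
have := deriv_Ppoly_e2 hB he12 he23 he; apply: contra => /eqP f0.
have [_ Pe2 _] := B1_root he.
have -> : (Ppoly c)^`().[e2] = 5 * e2 ^+ 4 + 3 * c.2 * e2 + 27 * c.1.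
  rewrite /Ppoly derivB !derivD !derivZ !derivXn derivX derivC !hornerE /=.
  by field.
rewrite -(mulrI_eq0 _ (mulfI e20)); apply/eqP.
have -> : e2 * (5 * e2 ^+ 4 + 3 * c.2 * e2 + 27 * c.1) =
    2 * (Ppoly c).[e2] +
    3 * e2 ^+ 3 * (e2 ^+ 2 - 9 * c.1 / e2 ^+ 2 * (1 - c.1 / e2)).
  by rewrite horner_Ppoly; field.
by rewrite f0 Pe2 !mulr0 addr0.
Qed.

Variables tau dtau : R -> R.
Hypothesis ode : forall s, twist_ode c tau dtau s.
Hypotheses (tau0 : tau 0 = e2) (dtau0 : dtau 0 = 0).

Let is_interval_setT : is_interval (setT : set R). Proof. by []. Qed.

Lemma twist_energy s : 3 / 2 * tau s ^+ 2 * dtau s ^+ 2 = (Ppoly c).[tau s].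
Proof.
by have [] := twist_ode_range is_interval_setT (I : setT 0) (fun u _ => ode u)
  tau0 dtau0 (I : setT s).
Qed.

Lemma twist_range s : e1 <= tau s <= e2.
Proof.
by have [] := twist_ode_range is_interval_setT (I : setT 0) (fun u _ => ode u)
  tau0 dtau0 (I : setT s).
Qed.

Lemma dtau_eq0 s : tau s = e2 -> dtau s = 0.
Proof.
have e20 := B1_e2_lt0 hB he12 he23 he; have [_ Pe2 _] := B1_root he.
move=> ts; have /eqP := twist_energy s; rewrite ts Pe2 !mulf_eq0 ?expf_eq0 /=.
by rewrite (lt_eqF e20) !pnatr_eq0 invr_eq0 pnatr_eq0 /= => /orP[] /eqP.
Qed.

(** A twist resting at [e2] on an interval would have zero second derivative there, against
    [twist_force_e2]. *)
Lemma twist_nonconstant a b : a < b -> exists2 s, a < s < b & tau s != e2.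
Proof.
move=> ab; apply: contrapT => none.
have te2 s : a < s < b -> tau s = e2.
  by move=> sab; apply: contrapT => ts; apply: none; exists s => //; exact/eqP.
pose m := (a + b) / 2.
have mab : a < m < b by rewrite /m; apply/andP; split; lra.
have dm : is_derive m 1 dtau 0.
  apply: (@near_eq_is_derive _ R R (cst 0) dtau m 1 0).
  have : \forall s \near m, `]a, b[%classic s.
    apply: open_nbhs_nbhs; split; first exact: itv_open.
    by rewrite /= in_itv.
  by apply: filterS => s; rewrite /= in_itv /= => /te2 /dtau_eq0 ->.
have [_ _ dm'] := ode m; have := twist_force_e2.
by rewrite -(te2 m mab) -(is_derive_derive1 dm') (is_derive_derive1 dm) eqxx.
Qed.

(** The reflected function solves the same initial value problem at 0. *)
Lemma twist_even s : tau (- s) = tau s /\ dtau (- s) = - dtau s.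
Proof.
have ode' u : twist_ode c (fun v => tau (- v)) (fun v => - dtau (- v)) u.
  have [tu tud tudd] := ode (- u); split => //; first exact: is_derive_reflect.
  by have := is_derive_opp (is_derive_reflect tudd); rewrite opprK.
have e u : tau (- u) = tau u.
  apply: (twist_ode_unique (c := c) (tau1 := fun v => tau (- v))
    (dtau1 := fun v => - dtau (- v)) (dtau2 := dtau)
    (ltW he12) (B1_e2_lt0 hB he12 he23 he) is_interval_setT (I : setT 0)
    _ _ _ _ (I : setT u)) => [v _|v _||].
  - by split; [exact: ode'|exact: twist_range].
  - by split; [exact: ode|exact: twist_range].
  - by rewrite /= oppr0.
  - by rewrite oppr0 dtau0 oppr0.
split=> //; have [_ sd _] := ode s; have [_ sd' _] := ode' s.
rewrite -(is_derive_derive1 sd); apply: oppr_inj; rewrite opprK.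
by rewrite -(is_derive_derive1 sd'); congr (derive1 _ s); apply/funext.
Qed.

(** The minimum over a period is below [e2], hence interior, since the endpoints have value [e2].
    The derivative vanishes there, and by the energy relation the minimum is a root of P. *)
Lemma twist_reaches_e1 T : 0 < T -> periodic tau T -> exists s, tau s = e1.
Proof.
move=> T0 tauT.
have ct (A : set R) : {within A, continuous tau}.
  apply: continuous_subspaceT => s; have [_ td _] := ode s.
  exact: is_derive_continuous td.
have [s sT smin] := EVT_min (ltW T0) (@ct _).
have [u uT tu] := twist_nonconstant T0.
have ts : tau s < e2.
  rewrite (@le_lt_trans _ _ (tau u))//.
    by apply: smin; rewrite in_itv /=; case/andP: uT => /ltW-> /ltW->.
  by rewrite lt_neqAle tu; have /andP[] := twist_range u.
have tauTe : tau T = e2 by rewrite -tau0 -(tauT 0) add0r.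
have sT' : s \in `]0, T[%R.
  move: sT; rewrite !in_itv /= !le_eqVlt => /andP[/orP[/eqP s0|->] /orP[/eqP sT|->//]].
  - by move: ts; rewrite -s0 tau0 ltxx.
  - by move: ts; rewrite -s0 tau0 ltxx.
  - by move: ts; rewrite sT tauTe ltxx.
have ds : is_derive s 1 tau 0.
  apply: (derive1_at_min (ltW T0) _ sT') => t tT; first by have [_ []] := ode t.
  by apply: smin; apply: subset_itv_oo_cc tT.
have [_ sd _] := ode s.
have Ps : root (Ppoly c) (tau s).
  rewrite /root -twist_energy -(is_derive_derive1 sd) (is_derive_derive1 ds).
  by rewrite expr0n mulr0.
exists s; move: Ps; rewrite he !inE (lt_eqF ts) /= (lt_eqF (lt_trans ts he23)) orbF.
by move/eqP.
Qed.

(** All abscissas are reached by the intermediate value theorem, and reflecting time changes the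
    sign of the ordinate, so both branches are covered. *)
Lemma signature_oval T : 0 < T -> periodic tau T ->
  signature tau @` setT = oval c e1 e2.
Proof.
move=> T0 tauT.
have dE s : derive1 tau s = dtau s by have [_ /is_derive_derive1] := ode s.
have sigE s : signature tau s = (tau s, Num.sqrt (3 / 2) * tau s * dtau s).
  by rewrite /signature dE.
have sig2 s : (Num.sqrt (3 / 2) * tau s * dtau s) ^+ 2 = (Ppoly c).[tau s].
  by rewrite -twist_energy !exprMn sqr_sqrtr.
apply/seteqP; split=> [_ [s _ <-]|[x y] [Qp /= xe]].
  by rewrite sigE; split; [exact: sig2|exact: twist_range].
have [s1 ts1] := twist_reaches_e1 T0 tauT.
have [s ts] : exists s, tau s = x.
  have ct (A : set R) : {within A, continuous tau}.
    apply: continuous_subspaceT => s; have [_ td _] := ode s.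
    exact: is_derive_continuous td.
  (* By evenness the value [e1] may be taken at a nonpositive time, which makes 0 the right
     endpoint. *)
  have [||s _ ts] := @IVT _ tau (- `|s1|) 0 x _ (@ct _).
  - by rewrite oppr_le0.
  - have -> : tau (- `|s1|) = e1.
      case: (ger0P s1) => _; last by rewrite opprK.
      by have [-> _] := twist_even s1.
    by rewrite tau0 min_l ?max_r ?(ltW he12).
  by exists s.
move: Qp; rewrite /quintic /= -ts -sig2 => /eqP; rewrite eqf_sqr => /orP[]/eqP ->.
  by exists s; rewrite ?sigE.
have [te de] := twist_even s.
by exists (- s) => //; rewrite sigE te de mulrN.
Qed.

Lemma twist_solution_type T : 0 < T -> periodic tau T -> type_B1' setT tau c.
Proof.
move=> T0 tauT; split=> //.
  have [s _ ts] := twist_nonconstant T0; exists s, 0; split=> //.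
  by rewrite tau0.
exists (e2, 0); last first.
  rewrite (oval_component hB he12 he23 he) (signature_oval T0 tauT).
  by split=> //; exact: (oval_compact hB he12 he23 he).
by have [_ Pe2 _] := B1_root he; rewrite /quintic /= Pe2 expr0n.
Qed.

Lemma twist_has_modulus : has_modulus setT (fun s => c.1 / tau s ^+ 2) tau c.
Proof.
move=> s _; have [t0 td _] := ode s; rewrite (is_derive_derive1 td).
split; first by field.
have := twist_energy s; rewrite horner_Ppoly => en.
have t20 : 3 / 2 * tau s ^+ 2 != 0 by rewrite mulf_neq0 ?expf_neq0.
apply: (mulfI t20).
have -> : 3 / 2 * tau s ^+ 2 * (- 18 * (c.1 / tau s ^+ 2) * tau s +
     9 * (c.1 / tau s ^+ 2) ^+ 2 * tau s ^+ 2 - 2 / 3 * tau s ^+ 3 + dtau s ^+ 2) =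
    3 / 2 * tau s ^+ 2 * dtau s ^+ 2 - 27 * c.1 * tau s + 27 / 2 * c.1 ^+ 2 - tau s ^+ 5.
  by field.
by rewrite en; field.
Qed.

End Twist.
(** * Phases and square roots *)

Section Phase.
Variable R : realType.
Local Notation C := R[i].

Lemma oriented_integral0_is_derive (f : R -> R) (s : R) : continuous f ->
  is_derive s 1 (oriented_integral0 f) (f s).
Proof.
move=> cf.
have intf (x y : R) (p q : bool) : lebesgue_measure.-integrable
    [set` Interval (BSide p x) (BSide q y)] (EFin \o f).
  have : lebesgue_measure.-integrable `[x, y] (EFin \o f).
    apply: continuous_compact_integrable; first exact: segment_compact.
    exact: continuous_subspaceT.
  apply: integrableS => //.
  case: p q => -[] //; first exact: subset_itv_co_cc.
    exact: subset_itv_oo_cc.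
  exact: subset_itv_oc_cc.
(* A base point to the left of both 0 and [s]: near [s] the oriented integral is then the difference
   [F x - F 0], whatever the sign of [x]. *)
pose a := Num.min s 0 - 1.
have [a0 as_] : a < 0 /\ a < s.
  by rewrite /a; split; rewrite ltrBlDr gt_min ltrDl ltr01 ?orbT.
pose F (x : R) := \int[lebesgue_measure]_(t in `[a, x]) f t.
have Fd : is_derive s 1 F (f s).
  have ss1 : s < s + 1 by rewrite ltrDl.
  have [dF F's] := continuous_FTC1_closed ss1 (intf a (s + 1) true false) as_ (cf s).
  by rewrite -F's; exact: derivable_is_derive1.
have near_eq : \forall x \near s, F x + - F 0 = oriented_integral0 f x.
  have : \forall x \near s, `]a, s + 1[%classic x.
    apply: open_nbhs_nbhs; split; first exact: itv_open.
    by rewrite /= in_itv /= as_ ltrDl ltr01.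
  apply: filterS => x; rewrite /= in_itv /= => /andP[ax _].
  rewrite /oriented_integral0 /F; case: leP => x0.
    rewrite (Rintegral_itvB (intf a x true false)) ?bnd_simp ?(ltW a0)//.
    by rewrite Rintegral_itv_obnd_cbnd//; exact: (intf 0 x false false).
  rewrite -opprB (Rintegral_itvB (intf a 0 true false)) ?bnd_simp ?(ltW ax) ?(ltW x0)//.
  by rewrite Rintegral_itv_obnd_cbnd//; exact: (intf x 0 false false).
have F0 : is_derive s 1 (fun=> - F 0) 0 := is_derive_cst _ s 1.
have := is_derive_add Fd F0; rewrite addr0.
exact: near_eq_is_derive.
Qed.

(** A continuous root of a positive function has constant sign, so it is a constant multiple of
    [Num.sqrt]. The derivative is stated in logarithmic form. *)
Lemma sqr_is_derive (g F : R -> R) (s d : R) : continuous g ->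
  (forall u, g u ^+ 2 = F u) -> (forall u, 0 < F u) -> is_derive s 1 F d ->
  is_derive s 1 g (d / (2 * F s) * g s).
Proof.
move=> cg gF F0 Fd.
have g0 u : g u != 0 by rewrite -sqrf_eq0 gF gt_eqF.
have gE : g = fun u => Num.sg (g s) * Num.sqrt (F u).
  apply/funext => u; rewrite -gF sqrtr_sqr.
  have -> : Num.sg (g s) = Num.sg (g u).
    by apply: (continuous_nonvanishing_sg (J := setT)) => // v _; exact: cg.
  by rewrite -numEsg.
have sd : is_derive s 1 (fun u => Num.sqrt (F u)) ((2 * Num.sqrt (F s))^-1 * d).
  exact: (is_derive1_comp (is_derive1_sqrt (F0 s)) Fd).
have cd : is_derive s 1 (fun=> Num.sg (g s)) 0 := is_derive_cst _ s 1.
rewrite {1}gE.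
have /is_derive_eq := is_derive_mul cd sd; apply.
have gs : g s = Num.sg (g s) * Num.sqrt (F s) by rewrite [LHS](congr1 (fun f => f s) gE).
have sF0 : Num.sqrt (F s) != 0 by rewrite gt_eqF// sqrtr_gt0.
rewrite [in RHS]gs -[X in _ / (_ * X) * _](sqr_sqrtr (ltW (F0 s))).
by field; rewrite sF0.
Qed.

(** The root is real if F > 0 and purely imaginary if F < 0; its logarithmic derivative F'/(2F) is
    the same in both cases. *)
Lemma sqrt_determination_cderive (F : R -> R) (r : R -> C) (s d : R) :
  sqrt_determination F r -> (forall u, 0 < F u) \/ (forall u, F u < 0) ->
  is_derive s 1 F d -> is_cderive r s ((d / (2 * F s))%:C * r s).
Proof.
move=> [cre cim rF] F0 Fd.
have re u : complex.Re (r u) ^+ 2 - complex.Im (r u) ^+ 2 = F u.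
  by have /(congr1 (@complex.Re R)) := rF u; rewrite expr2 ReM -!expr2.
have im u : complex.Re (r u) * complex.Im (r u) = 0.
  have /(congr1 (@complex.Im R)) := rF u; rewrite expr2 ImM /=; lra.
have reC (a : R) (z : C) : complex.Re (a%:C * z) = a * complex.Re z.
  by rewrite ReM /= mul0r subr0.
have imC (a : R) (z : C) : complex.Im (a%:C * z) = a * complex.Im z.
  by rewrite ImM /= mul0r addr0.
rewrite /is_cderive reC imC; case: F0 => F0.
- have im0 u : complex.Im (r u) = 0.
    apply: contrapT => /eqP imn0; have := F0 u; rewrite -re.
    have /eqP := im u; rewrite mulf_eq0 (negbTE imn0) orbF => /eqP ->.
    by rewrite expr0n sub0r oppr_gt0 ltNge sqr_ge0.
  split.
  + by apply: sqr_is_derive => // u; rewrite -re im0 expr0n subr0.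
  + rewrite im0 mulr0; under eq_fun do rewrite im0; exact: is_derive_cst.
- have re0 u : complex.Re (r u) = 0.
    apply: contrapT => /eqP ren0; have := F0 u; rewrite -re.
    have /eqP := im u; rewrite mulf_eq0 (negbTE ren0) /= => /eqP ->.
    by rewrite expr0n subr0 ltNge sqr_ge0.
  split.
  + rewrite re0 mulr0; under eq_fun do rewrite re0; exact: is_derive_cst.
  + have := is_derive_opp Fd => NFd.
    have := sqr_is_derive (g := fun u => complex.Im (r u)) cim _ _ NFd.
    move=> /(_ _ _)/is_derive_eq; apply.
    * by move=> u; rewrite -re re0 expr0n sub0r opprK.
    * by move=> u; rewrite oppr_gt0.
    * by rewrite mulrN invrN mulrNN.
Qed.

Lemma sqrt_determination_norm (F : R -> R) (r : R -> C) (s : R) :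
  sqrt_determination F r -> r s * conjc (r s) = `|F s|%:C.
Proof.
move=> [_ _ rF]; rewrite -sqr_normc -normrX rF.
by rewrite normc_def /= expr0n addr0 sqrtr_sqr.
Qed.

Lemma is_cderive_cexpi (p : R -> R) (s d : R) : is_derive s 1 p d ->
  is_cderive (fun u => cexpi (p u)) s ((0 +i* d) * cexpi (p s)).
Proof.
move=> pd; split.
- rewrite ReM /= mul0r sub0r.
  have /is_derive_eq := is_derive1_comp (is_derive_cos (p s)) pd; apply.
  by rewrite mulNr mulrC.
- rewrite ImM /= mul0r add0r.
  have /is_derive_eq := is_derive1_comp (is_derive_sin (p s)) pd; apply.
  by rewrite mulrC.
Qed.

Lemma cexpi_norm (x : R) : cexpi x * conjc (cexpi x) = 1.
Proof.
apply: complex_eq; rewrite ?ReM ?ImM /=; last by ring.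
by rewrite mulrN opprK -!expr2 cos2Dsin2.
Qed.

End Phase.
(** Reduces an equation modulo a relation [u = v] to a ring or field identity with the certificate
    [k]. *)
Lemma eq_of_comb (K : pzRingType) (x y k u v : K) :
  u = v -> x - y = k * (u - v) -> x = y.
Proof. by move=> ->; rewrite subrr mulr0 => /eqP; rewrite subr_eq0 => /eqP. Qed.

(** * Eigenvectors of the momentum *)

Section RowIdentities.
Variables (R : realType) (c1 c2 l t d : R).
Hypotheses (t0 : t != 0) (m0 : t ^+ 2 - 3 * l != 0).
Hypothesis root_l : l ^+ 3 + 6 * c1 * l + (27 + 3 * c2) = 0.
Hypothesis energy : 3 / 2 * t ^+ 2 * d ^+ 2 =
  t ^+ 5 + 3 / 2 * c2 * t ^+ 2 + 27 * c1 * t - 27 / 2 * c1 ^+ 2.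

(** With [t], [d], [f] for the twist and its first two derivatives, a left eigenvector of L is (1,
    q, w), where q = [al] + i [be] and w = [a] + i [b]. [da] and [db] are the derivatives of [a] and
    [b], and [k] is the bending. *)
Let m := t ^+ 2 - 3 * l.
Let f := t ^+ 2 - 9 * c1 / t ^+ 2 * (1 - c1 / t).
Let n := l ^+ 2 - 3 * t + 3 * c1.
Let a := t * d / m.
Let b := n / m.
Let al := (l + 3 * b) / t.
Let be := - 3 * a / t.
Let k := c1 / t ^+ 2.
Let y := 3 * (1 - t * k).
Let da := (d ^+ 2 + t * f) / m - 2 * t ^+ 2 * d ^+ 2 / m ^+ 2.
Let db := - 3 * d / m - 2 * t * d * n / m ^+ 2.

(** The energy relation solved for [d ^+ 2], with c2 eliminated by Q(l) = 0. The identities below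
    that are not purely rational hold modulo this one relation. *)
Let d2 : d ^+ 2 = 2 / 3 / t ^+ 2 * (t ^+ 5 + 3 / 2 * (- 9 - (l ^+ 3 + 6 * c1 * l) / 3)
   * t ^+ 2 + 27 * c1 * t - 27 / 2 * c1 ^+ 2).
Proof.
have -> : - 9 - (l ^+ 3 + 6 * c1 * l) / 3 = c2 by have h := root_l; lra.
by rewrite -energy; field.
Qed.

(** With [row_w_im], the two parts of the Riccati equation w' + w^2 = t + q, which is the third
    column of F' = F K once z' = z (w + i k) is factored out. *)
Lemma row_w_re : a ^+ 2 - b ^+ 2 + da = t + al.
Proof.
by apply: (eq_of_comb (k := - 3 * l / m ^+ 2) d2);
  rewrite /da /al /a /b /n /f /m; field; rewrite t0 m0.
Qed.

Lemma row_w_im : 2 * a * b + db = be.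
Proof. by rewrite /db /be /a /b /n /m; field; rewrite t0 m0. Qed.

(** With [row_q_im], the two parts of q' + (w + i k) q = - i - 2 i k q, the second column of F' = F
    K. *)
Lemma row_q_re : 3 * db / t - (l + 3 * b) * d / t ^+ 2 + a * al - (k + b) * be =
  2 * k * be.
Proof. by rewrite /db /be /al /a /b /n /k /m; field; rewrite t0 m0. Qed.

Lemma row_q_im : - 3 * da / t + 3 * a * d / t ^+ 2 + a * be + (k + b) * al =
  - 1 - 2 * k * al.
Proof.
by apply: (eq_of_comb (k := 3 * t / m ^+ 2) d2);
  rewrite /da /be /al /a /b /n /f /k /m; field; rewrite t0 m0.
Qed.

(** This and the next three are the second and third entries of (1, q, w) L = l (1, q, w); the first
    entry is what defines [al] and [be]. *)
Lemma row_momentum2_re : y + t * b = l * al.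
Proof. by rewrite /y /al /b /n /k /m; field; rewrite t0 m0. Qed.

Lemma row_momentum2_im : d - t * a = l * be.
Proof. by rewrite /be /a /m; field; rewrite t0 m0. Qed.

Lemma row_momentum3_re : al * d - be * y = l * a.
Proof. by rewrite /y /al /be /a /b /n /k /m; field; rewrite t0 m0. Qed.

Lemma row_momentum3_im : 2 * t + al * y + be * d = l * b.
Proof.
by apply: (eq_of_comb (k := - 3 / m) d2);
  rewrite /y /al /be /a /b /n /k /m; field; rewrite t0 m0.
Qed.

(** The numerator is Q'(l), a product of differences of eigenvalues; the constants [rho1], [rho2],
    [rho3] compensate it. *)
Lemma row_norm : al ^+ 2 + be ^+ 2 + 2 * b = (3 * l ^+ 2 + 6 * c1) / m.
Proof.
by apply: (eq_of_comb (k := 9 / m ^+ 2) d2);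
  rewrite /al /be /a /b /n /m; field; rewrite t0 m0.
Qed.

(** Identifies the integrand of the phases with the imaginary part of w + i k = z'/z. *)
Lemma row_phase : k + b =
  (3 * c1 * l - (4 * c1 + l ^+ 2) * t ^+ 2 + 3 * t ^+ 3)
    / (t ^+ 2 * (3 * l - t ^+ 2)).
Proof.
have m0' : 3 * l - t ^+ 2 != 0 by rewrite -opprB oppr_eq0.
by rewrite /k /b /n /m; field; rewrite t0 m0 m0'.
Qed.

End RowIdentities.
Section EigenRows.
Variables (R : realType) (c : R * R) (tau dtau : R -> R).
Local Notation C := R[i].
Hypothesis ode : forall s, twist_ode c tau dtau s.
Hypothesis energy : forall s,
  3 / 2 * tau s ^+ 2 * dtau s ^+ 2 = (Ppoly c).[tau s].

Let kap s := c.1 / tau s ^+ 2.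
Let m l s := tau s ^+ 2 - 3 * l.
Let n l s := l ^+ 2 - 3 * tau s + 3 * c.1.
Definition row_a l s := tau s * dtau s / m l s.
Definition row_b l s := n l s / m l s.
(* [(1, row_q l s, row_w l s)] is the left eigenvector of the matrix [L] of the
   momentum for the eigenvalue [l], normalized by its first entry. *)
Definition row_q l s : C :=
  ((l + 3 * row_b l s) / tau s) +i* (- 3 * row_a l s / tau s).
Definition row_w l s : C := row_a l s +i* row_b l s.


Let row_a_derive l s : m l s != 0 -> is_derive s 1 (row_a l)
  ((dtau s ^+ 2 + tau s * (tau s ^+ 2 - 9 * c.1 / tau s ^+ 2 * (1 - c.1 / tau s)))
     / m l s - 2 * tau s ^+ 2 * dtau s ^+ 2 / m l s ^+ 2).
Proof.
move=> m0; have [t0 td tdd] := ode s.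
have cd (a : R) : is_derive s 1 (fun=> a) 0 := is_derive_cst a s 1.
have md := is_derive_add (is_derive_sqr td) (cd (- (3 * l))).
have /is_derive_eq := is_derive_mul (is_derive_mul td tdd) (is_derive_inv (f := m l) m0 md).
by apply; field; rewrite m0 t0.
Qed.

Lemma row_b_derive l s : m l s != 0 -> is_derive s 1 (row_b l)
  (- 3 * dtau s / m l s - 2 * tau s * dtau s * n l s / m l s ^+ 2).
Proof.
move=> m0; have [t0 td tdd] := ode s.
have cd (a : R) : is_derive s 1 (fun=> a) 0 := is_derive_cst a s 1.
have md := is_derive_add (is_derive_sqr td) (cd (- (3 * l))).
have nd := is_derive_add (is_derive_add (cd (l ^+ 2))
  (is_derive_opp (is_derive_mul (cd 3) td))) (cd (3 * c.1)).
have /is_derive_eq := is_derive_mul nd (is_derive_inv (f := m l) m0 md).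
by apply; rewrite /n; field; rewrite m0.
Qed.

Variable l : R.
Hypothesis ml : forall s, m l s != 0.
Hypothesis root_l : (Qpoly c).[l] = 0.
Variable z : R -> C.
Hypothesis zd : forall s, is_cderive z s
  (z s * (row_a l s +i* (kap s + row_b l s))).

Let root_l' : l ^+ 3 + 6 * c.1 * l + (27 + 3 * c.2) = 0.
Proof. by rewrite -root_l horner_Qpoly. Qed.

Let energy' s := etrans (energy s) (horner_Ppoly c (tau s)).

Lemma row1_cderive s : is_cderive z s (z s * (0 +i* kap s) + z s * row_w l s).
Proof.
apply: is_cderive_eq (zd s) _; rewrite -mulrDr; congr (_ * _).
by apply: complex_eq; rewrite ?ReD ?ImD /= ?add0r.
Qed.

Lemma row_w_cderive s : is_cderive (fun u => z u * row_w l u) s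
  (z s * (tau s)%:C + z s * row_q l s + z s * row_w l s * (0 +i* kap s)).
Proof.
have [t0 td tdd] := ode s.
have wd : is_cderive (row_w l) s
    ((_ : R) +i* (_ : R)) := conj (row_a_derive (ml s)) (row_b_derive (ml s)).
apply: is_cderive_eq (is_cderive_mul (zd s) wd) _.
rewrite -!mulrA -!mulrDr; congr (_ * _).
have re := row_w_re t0 (ml s) root_l' (energy' s).
have im := row_w_im c.1 (dtau s) t0 (ml s).
apply: complex_eq; rewrite ?(ReD, ImD, ReM, ImM) /=.
- move: re; rewrite /row_a /row_b -/(m l s) -/(n l s) /kap; lra.
- move: im; rewrite /row_a /row_b -/(m l s) -/(n l s) /kap; lra.
Qed.

Lemma row_q_cderive s : is_cderive (fun u => z u * row_q l u) s
  (z s * - 'i%C + z s * row_q l s * (0 +i* (- 2 * kap s))).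
Proof.
have [t0 td tdd] := ode s.
have cd (a : R) : is_derive s 1 (fun=> a) 0 := is_derive_cst a s 1.
have tVd := is_derive_inv t0 td.
have ald := is_derive_mul (is_derive_add (cd l)
  (is_derive_mul (cd 3) (row_b_derive (ml s)))) tVd.
have bed := is_derive_mul (is_derive_mul (cd (- 3)) (row_a_derive (ml s))) tVd.
have qd : is_cderive (row_q l) s ((_ : R) +i* (_ : R)) := conj ald bed.
apply: is_cderive_eq (is_cderive_mul (zd s) qd) _.
rewrite -!mulrA -!mulrDr; congr (_ * _).
have re := row_q_re c.1 (dtau s) t0 (ml s).
have im := row_q_im t0 (ml s) root_l' (energy' s).
apply: complex_eq; rewrite ?(ReD, ImD, ReM, ImM) /=.
- move: re; rewrite /row_a /row_b -/(m l s) -/(n l s) /kap; lra.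
- move: im; rewrite /row_a /row_b -/(m l s) -/(n l s) /kap; lra.
Qed.

Let y s := 3 * (1 - tau s * kap s).

Lemma row_momentum1 s : row_q l s * (tau s)%:C + row_w l s * (0 +i* 3) = l%:C.
Proof.
have [t0 _ _] := ode s.
by apply: complex_eq; rewrite ?(ReD, ImD, ReM, ImM) /=; field.
Qed.

Lemma row_momentum2 s : (y s +i* dtau s) + row_w l s * (0 +i* - tau s) =
  l%:C * row_q l s.
Proof.
have [t0 _ _] := ode s.
have re := row_momentum2_re c.1 t0 (ml s).
have im := row_momentum2_im (dtau s) t0 (ml s).
apply: complex_eq; rewrite ?(ReD, ImD, ReM, ImM) /=.
- move: re; rewrite /y /row_a /row_b -/(m l s) -/(n l s) /kap; lra.
- move: im; rewrite /y /row_a /row_b -/(m l s) -/(n l s) /kap; lra.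
Qed.

Lemma row_momentum3 s : (0 +i* (2 * tau s)) + row_q l s * (dtau s +i* y s) =
  l%:C * row_w l s.
Proof.
have [t0 _ _] := ode s.
have re := row_momentum3_re c.1 (dtau s) t0 (ml s).
have im := row_momentum3_im t0 (ml s) root_l' (energy' s).
apply: complex_eq; rewrite ?(ReD, ImD, ReM, ImM) /=.
- move: re; rewrite /y /row_a /row_b -/(m l s) -/(n l s) /kap; lra.
- move: im; rewrite /y /row_a /row_b -/(m l s) -/(n l s) /kap; lra.
Qed.

(* The left side is [r h r^*] for the row [r = (1, row_q l s, row_w l s)]. *)
Lemma row_hnorm s :
  row_w l s * - 'i%C + row_q l s * conjc (row_q l s) + 'i%C * conjc (row_w l s) =
  ((3 * l ^+ 2 + 6 * c.1) / m l s)%:C.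
Proof.
have [t0 _ _] := ode s.
have nm := row_norm t0 (ml s) root_l' (energy' s).
apply: complex_eq; rewrite ?(ReD, ImD, ReM, ImM) /=; last by ring.
move: nm; rewrite /row_a /row_b -/(m l s) -/(n l s); lra.
Qed.

End EigenRows.

(** * Assembly of a frame from three eigenrows *)

Section FrameAssembly.
Variable R : realType.
Local Notation C := R[i].

Lemma det_frame_const (F : R -> 'M[C]_3) (kappa tau : R -> R) s t :
  (forall u, is_mxderive F u (F u *m Kmx (kappa u) (tau u))) ->
  \det (F s) = \det (F t).
Proof.
move=> Fd.
apply: (is_cderive0_const (J := setT) (f := fun u => \det (F u))) => // u _.
under eq_fun do rewrite det3E.
have e k l := Fd u k l.
have minor k l k' l' p q p' q' :=
  is_cderive_add (is_cderive_mul (e k l) (e k' l'))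
    (is_cderive_scale (-1) (is_cderive_mul (e p q) (e p' q'))).
have := is_cderive_add (is_cderive_add
  (is_cderive_mul (e i0 i0) (minor i1 i1 i2 i2 i1 i2 i2 i1))
  (is_cderive_scale (-1) (is_cderive_mul (e i0 i1) (minor i1 i0 i2 i2 i1 i2 i2 i0))))
  (is_cderive_mul (e i0 i2) (minor i1 i0 i2 i1 i1 i1 i2 i0)).
under eq_fun do rewrite !mulN1r.
move/is_cderive_eq; apply.
(* Makes the vanishing of the trace of K visible: the derivative of the determinant is the
   determinant times this trace. *)
have e2 : (0 +i* (- 2 * kappa u)) = - 2 * (0 +i* kappa u) :> C.
  by apply: complex_eq; rewrite ?ReM ?ImM /=; ring.
rewrite !mxE !sum3E !mxE /= e2; ring.
Qed.

Lemma det_hmx : \det (hmx R) = -1.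
Proof. by rewrite det3E !mxE /=; apply: complex_eq => /=; ring. Qed.

(** Determinants in the hypothesis give |det A| = 1, so a cube root of the inverse determinant has
    modulus 1, and scaling by it keeps the form. *)
Lemma inG_scale (A : 'M[C]_3) : A *m hmx R *m ctr A = hmx R ->
  exists om : C, [/\ om != 0, om ^+ 3 * \det A = 1 & om * conjc om = 1].
Proof.
move=> AA.
have dA : \det A * conjc (\det A) = 1.
  have := congr1 (fun M : 'M[C]_3 => \det M) AA.
  by rewrite !det_mulmx det_ctr det_hmx mulrN1 mulNr => /oppr_inj.
have dA0 : \det A != 0.
  by apply/eqP => d0; move/eqP: dA; rewrite d0 mul0r eq_sym oner_eq0.
pose om : C := 3.-root ((\det A)^-1).
have om3 : om ^+ 3 = (\det A)^-1 by rewrite rootCK.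
have omn : om * conjc om = 1.
  have : `|om| ^+ 3 = 1.
    rewrite -normrX om3 normfV; apply/eqP; rewrite invr_eq1.
    by rewrite -(@eqrXn2 _ 2) ?expr1n// sqr_normc dA.
  by move/eqP; rewrite pexpr_eq1// => /eqP om1; rewrite -sqr_normc om1 expr1n.
exists om; split=> //; last by rewrite om3 mulVf.
by apply/eqP => o0; move/eqP: omn; rewrite o0 mul0r eq_sym oner_eq0.
Qed.

(** Self-adjointness for the form on rows, the source of the orthogonality of the eigenrows. *)
Lemma Lmx_selfadjoint (k t t' : R) :
  Lmx k t t' *m hmx R = hmx R *m ctr (Lmx k t t').
Proof.
by apply/matrixP; apply: ord3_ind; apply: ord3_ind; rewrite !mxE !sum3E !mxE /=;
  apply: complex_eq; rewrite ?(ReD, ImD, ReM, ImM) /=; ring.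
Qed.

(** The columns are eigenvectors of the standard momentum, and applied to (z1, z2, z3) the matrix
    gives the vector of the explicit curve. *)
Definition eigen_basis (eps : R) : 'M[C]_3 :=
  mx3 [:: [:: 0; 1; 1]; [:: 0 +i* eps; 0; 0];
          [:: 0; - (0 +i* eps); 0 +i* eps]].

(** The diagonal lists the norms that the eigenrows must have; its signs reproduce the signature
    (2,1). *)
Lemma eigen_basis_coform (eps : R) : eps ^+ 2 = 1 ->
  eigen_basis eps *m
    diag_mx (\row_(j < 3) ([:: 1; eps / 2; - eps / 2]`_j)%:C) *m
    ctr (eigen_basis eps) = hmx R.
Proof.
move=> e1.
by apply/matrixP; apply: ord3_ind; apply: ord3_ind; rewrite mul_mx_diag !mxE !sum3E !mxE /=;
  apply: complex_eq; rewrite ?(ReD, ImD, ReM, ImM) /=; lra.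
Qed.

Lemma standard_momentum_basis (e2 l1 l2 l3 : R) : epsilon e2 l3 ^+ 2 = 1 ->
  standard_momentum e2 l1 l2 l3 *m eigen_basis (epsilon e2 l3) =
  eigen_basis (epsilon e2 l3) *m diag_mx (\row_(j < 3) ([:: l1; l2; l3]`_j)%:C).
Proof.
set eps := epsilon e2 l3 => e1.
apply/matrixP; apply: ord3_ind; apply: ord3_ind; rewrite mul_mx_diag !mxE ?sum3E !mxE /= -/eps;
  apply: complex_eq; rewrite ?(ReD, ImD, ReM, ImM) /=; try ring.
- by apply: (eq_of_comb (k := (l2 - l3) / 2) e1); field.
- by apply: (eq_of_comb (k := (l3 - l2) / 2) e1); field.
- by field.
- by field.
Qed.

Variables (c : R * R) (tau dtau : R -> R).
Hypothesis ode : forall s, twist_ode c tau dtau s.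
Hypothesis energy : forall s,
  3 / 2 * tau s ^+ 2 * dtau s ^+ 2 = (Ppoly c).[tau s].
Variables (l : 'I_3 -> R) (z : 'I_3 -> R -> C) (g : 'I_3 -> R).
Hypothesis l_inj : injective l.
Hypothesis ml : forall j s, tau s ^+ 2 - 3 * l j != 0.
Hypothesis root_l : forall j, (Qpoly c).[l j] = 0.
Hypothesis zd : forall j s, is_cderive (z j) s
  (z j s * (row_a tau dtau (l j) s +i* (c.1 / tau s ^+ 2 + row_b c tau (l j) s))).
Hypothesis zn : forall j s, z j s * conjc (z j s) *
  ((3 * l j ^+ 2 + 6 * c.1) / (tau s ^+ 2 - 3 * l j))%:C = (g j)%:C.

Definition eigen_rows s : 'M[C]_3 := \matrix_(j < 3, k < 3)
  (z j s * [:: 1; row_q c tau dtau (l j) s; row_w c tau dtau (l j) s]`_k).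
Let N := eigen_rows.
Let kap s := c.1 / tau s ^+ 2.

Lemma eigen_rows_derive s : is_mxderive N s (N s *m Kmx (kap s) (tau s)).
Proof.
move=> j; apply: ord3_ind; rewrite !mxE sum3E !mxE /=.
- under eq_fun do rewrite mxE /= mulr1.
  by apply: is_cderive_eq (row1_cderive (zd j) s) _; ring.
- under eq_fun do rewrite mxE /=.
  by apply: is_cderive_eq (row_q_cderive ode energy (ml j) (root_l j) (zd j) s) _; ring.
- under eq_fun do rewrite mxE /=.
  by apply: is_cderive_eq (row_w_cderive ode energy (ml j) (root_l j) (zd j) s) _; ring.
Qed.

Lemma eigen_rows_momentum s : N s *m Lmx (kap s) (tau s) (dtau s) =
  diag_mx (\row_j (l j)%:C) *m N s.
Proof.
rewrite mul_diag_mx; apply/matrixP => j; apply: ord3_ind; rewrite !mxE sum3E !mxE /=.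
- have e := row_momentum1 ode (l j) s.
  by apply: (eq_of_comb (k := z j s) e); ring.
- have e := row_momentum2 ode (ml j) s.
  by apply: (eq_of_comb (k := z j s) e); ring.
- have e := row_momentum3 ode energy (ml j) (root_l j) s.
  by apply: (eq_of_comb (k := z j s) e); ring.
Qed.

(** By self-adjointness of L the Gram matrix [X] commutes with [D], whose entries are distinct, so
    [X] is diagonal; [row_hnorm] and [zn] give its diagonal. *)
Lemma eigen_rows_coform s : N s *m hmx R *m ctr (N s) = diag_mx (\row_j (g j)%:C).
Proof.
set X := N s *m hmx R *m ctr (N s); set D := diag_mx (\row_j (l j)%:C).
have DX : D *m X = X *m D.
  rewrite /X !mulmxA -eigen_rows_momentum -(mulmxA (N s)) Lmx_selfadjoint !mulmxA.
  rewrite -(mulmxA _ (ctr (Lmx _ _ _))) -ctrM eigen_rows_momentum ctrM -!mulmxA.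
  congr (_ *m (_ *m (_ *m _))).
  (* What remains is that [D] equals its conjugate transpose, the eigenvalues being real. *)
  apply/matrixP => j k; rewrite !mxE eq_sym; case: eqP => [->|_]; rewrite ?mulr1n ?mulr0n.
    by apply: complex_eq => /=; rewrite ?oppr0.
  by apply: complex_eq => /=; rewrite ?oppr0.
apply/matrixP => j k; rewrite [RHS]mxE.
case: (eqVneq j k) => [<-|jk]; last first.
  rewrite mulr0n; have := congr1 (fun M : 'M[C]_3 => M j k) DX.
  rewrite mul_diag_mx mul_mx_diag !mxE => /eqP.
  rewrite [X in _ == X]mulrC -subr_eq0 -mulrBl mulf_eq0 => /orP[|/eqP //].
  rewrite -rmorphB /= eq_complex /= eqxx andbT subr_eq0 => /eqP /l_inj jk'.
  by rewrite jk' eqxx in jk.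
rewrite mulr1n [RHS]mxE -(zn j s) -(row_hnorm ode energy (ml j) (root_l j)).
rewrite /X mxE sum3E !mxE !sum3E !mxE /=.
rewrite mulr1 !rmorphM /=; ring.
Qed.

End FrameAssembly.
(** * The explicit curve *)

Section ExplicitCurve.
Variables (R : realType) (c : R * R) (e1 e2 e3 l1 l2 l3 : R) (tau : R -> R).
Local Notation C := R[i].
Hypotheses (hB : B1 c) (hgen : general c).
Hypotheses (he12 : e1 < e2) (he23 : e2 < e3).
Hypothesis he : forall x, root (Ppoly c) x = (x \in [:: e1; e2; e3]).
Hypotheses (hl12 : l1 < l2) (hl23 : l2 < l3).
Hypothesis hl : forall x, root (Qpoly c) x = (x \in [:: l1; l2; l3]).
Let dtau := derive1 tau.
Hypothesis ode : forall s, twist_ode c tau dtau s.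
Hypotheses (tau0 : tau 0 = e2) (dtau0 : dtau 0 = 0).

Let energy s := twist_energy hB he12 he23 he ode tau0 dtau0 s.
Let range s := twist_range hB he12 he23 he ode tau0 dtau0 s.
Let dichotomy s := sqr_twist_dichotomy hB he12 he23 he hl12 hl23 hl hgen (range s).
Let eps := epsilon e2 l3.

(** [tau s ^+ 2 - 3 * l3] never vanishes, so its sign at 0, where the twist is [e2], persists and
    selects one side of the dichotomy for all times. *)
Lemma epsilon_cases : (eps = 1 /\ forall s, tau s ^+ 2 < 3 * l2) \/
                      (eps = -1 /\ forall s, 3 * l3 < tau s ^+ 2).
Proof.
have l23 := hl23.
pose f s := tau s ^+ 2 + - (3 * l3).
have f0 s : f s != 0.
  by rewrite subr_eq0; have [_ []] := dichotomy s => h; [rewrite lt_eqF|rewrite gt_eqF]; lra.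
have sgf s : Num.sg (f s) = Num.sg (f 0).
  apply: (continuous_nonvanishing_sg (J := setT)) => // u _.
  have [_ td _] := ode u.
  have := is_derive_add (is_derive_sqr td) (is_derive_cst (- (3 * l3)) u (1 : R)).
  exact: is_derive_continuous.
have epsE : eps = - Num.sg (f 0) by rewrite /f tau0.
have [_ [h|h]] := dichotomy 0.
- have f00 : f 0 < 0 by rewrite /f; lra.
  left; split; first by rewrite epsE ltr0_sg ?opprK.
  move=> s; have [_ [//|h']] := dichotomy s.
  have /eqP := sgf s; rewrite (ltr0_sg f00) sgr_cp0 /f => fs; lra.
- have f00 : 0 < f 0 by rewrite /f; lra.
  right; split; first by rewrite epsE gtr0_sg.
  move=> s; have [_ [h'|//]] := dichotomy s.
  have /eqP := sgf s; rewrite (gtr0_sg f00) sgr_cp0 /f => fs; lra.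
Qed.

Lemma epsilon_sqr : eps ^+ 2 = 1.
Proof. by case: epsilon_cases => -[-> _]; rewrite ?sqrrN expr1n. Qed.

Let lam (j : 'I_3) : R := [:: l1; l2; l3]`_j.

Let lam_inj : injective lam.
Proof.
have l12 := hl12; have l23 := hl23.
apply: ord3_ind; apply: ord3_ind => //; rewrite /lam /= => h; exfalso; lra.
Qed.

Let lam_neq (j : 'I_3) s : tau s ^+ 2 - 3 * lam j != 0.
Proof.
have l12 := hl12; have l23 := hl23.
have [h1 h23] := dichotomy s; rewrite subr_eq0.
move: j; apply: ord3_ind; rewrite /lam /=; first by rewrite gt_eqF.
- by case: h23 => h; [rewrite lt_eqF|rewrite gt_eqF]; lra.
- by case: h23 => h; [rewrite lt_eqF|rewrite gt_eqF]; lra.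
Qed.

Let lam_root (j : 'I_3) : (Qpoly c).[lam j] = 0.
Proof.
by apply/rootP; rewrite hl; move: j; apply: ord3_ind; rewrite !inE /lam /= eqxx ?orbT.
Qed.

Lemma phi_is_derive (j : 'I_3) (s : R) : is_derive s 1 (phi c tau (lam j))
  (c.1 / tau s ^+ 2 + row_b c tau (lam j) s).
Proof.
have -> : phi c tau (lam j) = oriented_integral0
    (fun u => c.1 * (tau u ^+ 2)^-1 + row_b c tau (lam j) u).
  apply/funext => u; rewrite /phi; congr (oriented_integral0 _ _).
  apply/funext => v; have [t0 _ _] := ode v; rewrite /row_b.
  by rewrite (row_phase c.1 t0 (lam_neq j v)).
apply: (@oriented_integral0_is_derive _
  (fun u => c.1 * (tau u ^+ 2)^-1 + row_b c tau (lam j) u)) => u.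
have [t0 td _] := ode u.
have t20 : tau u ^+ 2 != 0 by rewrite expf_neq0.
have kd := is_derive_mul (is_derive_cst c.1 u (1 : R))
  (is_derive_inv (f := fun v => tau v ^+ 2) t20 (is_derive_sqr td)).
exact: is_derive_continuous (is_derive_add kd (row_b_derive ode (lam_neq j u))).
Qed.

Variables r1 r2 r3 : R -> C.
Hypothesis hr1 : sqrt_determination (fun s => 3 * (l2 + l3) + tau s ^+ 2) r1.
Hypothesis hr2 : sqrt_determination (fun s => 3 * l2 - tau s ^+ 2) r2.
Hypothesis hr3 : sqrt_determination (fun s => 3 * l3 - tau s ^+ 2) r3.

Let rho (j : 'I_3) : R := [:: rho1 l2 l3; rho2 l2 l3; rho3 l2 l3]`_j.
Let rad (j : 'I_3) : R -> C := nth r1 [:: r1; r2; r3] j.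
Let z (j : 'I_3) s : C := (rho j)%:C * rad j s * cexpi (phi c tau (lam j) s).

(** [row_a] is half the logarithmic derivative of [tau ^+ 2 - 3 * lam j]. The first radicand has
    this form because the eigenvalues sum to 0. *)
Let radd j s : is_cderive (rad j) s ((row_a tau dtau (lam j) s)%:C * rad j s).
Proof.
have l23 := hl23; have l12 := hl12.
have [l1E _ _] := Qpoly_vieta hl12 hl23 hl.
have [t0 td _] := ode s.
have cd (a : R) : is_derive s 1 (fun=> a) 0 := is_derive_cst a s 1.
have lneq := lam_neq j s; rewrite /row_a.
move: j lneq; apply: ord3_ind; rewrite /lam /rad /= => lneq.
- have Fd := is_derive_add (cd (3 * (l2 + l3))) (is_derive_sqr td).
  have F0 u : 0 < 3 * (l2 + l3) + tau u ^+ 2 by have [h _] := dichotomy u; lra.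
  apply: is_cderive_eq (sqrt_determination_cderive hr1 (or_introl F0) Fd) _.
  congr (_%:C * _); rewrite l1E; field.
  by rewrite l1E in lneq.
- have Fd := is_derive_add (cd (3 * l2)) (is_derive_opp (is_derive_sqr td)).
  have F0 : (forall u, 0 < 3 * l2 - tau u ^+ 2) \/ (forall u, 3 * l2 - tau u ^+ 2 < 0).
    by case: epsilon_cases => -[_ h]; [left|right] => u; have := h u; lra.
  apply: is_cderive_eq (sqrt_determination_cderive hr2 F0 Fd) _.
  have lneq' : 3 * l2 - tau s ^+ 2 != 0 by rewrite -opprB oppr_eq0.
  by congr (_%:C * _); field; rewrite lneq lneq'.
- have Fd := is_derive_add (cd (3 * l3)) (is_derive_opp (is_derive_sqr td)).
  have F0 : (forall u, 0 < 3 * l3 - tau u ^+ 2) \/ (forall u, 3 * l3 - tau u ^+ 2 < 0).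
    by case: epsilon_cases => -[_ h]; [left|right] => u; have := h u; lra.
  apply: is_cderive_eq (sqrt_determination_cderive hr3 F0 Fd) _.
  have lneq' : 3 * l3 - tau s ^+ 2 != 0 by rewrite -opprB oppr_eq0.
  by congr (_%:C * _); field; rewrite lneq lneq'.
Qed.

Let zd j s : is_cderive (z j) s
  (z j s * (row_a tau dtau (lam j) s +i* (c.1 / tau s ^+ 2 + row_b c tau (lam j) s))).
Proof.
have pd := is_cderive_cexpi (phi_is_derive j s).
apply: is_cderive_eq (is_cderive_mul (is_cderive_scale (rho j)%:C (radd j s)) pd) _.
rewrite /z; set kb := c.1 / _ + _; set a := row_a _ _ _ _.
have -> : a +i* kb = a%:C + (0 +i* kb) :> C.
  by apply: complex_eq; rewrite ?ReD ?ImD /= ?addr0 ?add0r.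
by ring.
Qed.

(** The absolute values of the radicands: the last two have the same sign, that of [eps]. *)
Let radn (j : 'I_3) s : R := [:: tau s ^+ 2 - 3 * l1;
  eps * (3 * l2 - tau s ^+ 2); eps * (3 * l3 - tau s ^+ 2)]`_j.

Let rad_norm j s : rad j s * conjc (rad j s) = (radn j s)%:C.
Proof.
have l23 := hl23; have l12 := hl12.
have [l1E _ _] := Qpoly_vieta hl12 hl23 hl.
have [h1 _] := dichotomy s.
move: j; apply: ord3_ind; rewrite /rad /radn /=.
- rewrite (sqrt_determination_norm s hr1); congr (_%:C).
  by rewrite ger0_norm; lra.
- rewrite (sqrt_determination_norm s hr2); congr (_%:C).
  case: epsilon_cases => -[-> /(_ s) h].
    by rewrite mul1r ger0_norm//; lra.
  by rewrite mulN1r ler0_norm//; lra.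
- rewrite (sqrt_determination_norm s hr3); congr (_%:C).
  case: epsilon_cases => -[-> /(_ s) h].
    by rewrite mul1r ger0_norm//; lra.
  by rewrite mulN1r ler0_norm//; lra.
Qed.

(** The inverse squares of the [rho j] are Q'(l1), -2 Q'(l2) and 2 Q'(l3), and [q1], [q2], [q3]
    factor these derivatives; the norms come out as in [eigen_basis_coform]. *)
Let zn j s : z j s * conjc (z j s) *
  ((3 * lam j ^+ 2 + 6 * c.1) / (tau s ^+ 2 - 3 * lam j))%:C =
  ([:: 1; eps / 2; - eps / 2]`_j)%:C.
Proof.
have l23 := hl23; have l12 := hl12.
have [l1E c1E _] := Qpoly_vieta hl12 hl23 hl.
have -> : z j s * conjc (z j s) = (rho j ^+ 2 * radn j s)%:C.
  have rr : conjc (rho j)%:C = (rho j)%:C by apply: complex_eq => /=; rewrite ?oppr0.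
  have cM (x y : C) : conjc (x * y) = conjc x * conjc y := rmorphM _ x y.
  have rM (x y : R) : (x * y)%:C = x%:C * y%:C :> C := rmorphM (real_complex R) x y.
  rewrite rM expr2 rM -rad_norm /z !cM rr.
  apply: (eq_of_comb (k := (rho j)%:C ^+ 2 * (rad j s * conjc (rad j s)))
    (cexpi_norm (phi c tau (lam j) s))).
  by ring.
rewrite -rmorphM /=; congr (_%:C).
have lneq := lam_neq j s; rewrite c1E.
have a1 : l2 - l1 != 0 by rewrite subr_eq0 gt_eqF.
have a2 : l3 - l2 != 0 by rewrite subr_eq0 gt_eqF.
have a3 : l3 - l1 != 0 by rewrite subr_eq0 gt_eqF//; lra.
have b1 : 2 * l2 + l3 = l2 - l1 by lra.
have b2 : l2 + 2 * l3 = l3 - l1 by lra.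
have q1 : 3 * l1 ^+ 2 + (l1 * l2 + l1 * l3 + l2 * l3) = (l2 - l1) * (l3 - l1).
  by rewrite l1E; ring.
have q2 : 3 * l2 ^+ 2 + (l1 * l2 + l1 * l3 + l2 * l3) = - ((l2 - l1) * (l3 - l2)).
  by rewrite l1E; ring.
have q3 : 3 * l3 ^+ 2 + (l1 * l2 + l1 * l3 + l2 * l3) = (l3 - l1) * (l3 - l2).
  by rewrite l1E; ring.
move: j lneq; apply: ord3_ind; rewrite /lam /rho /radn /= => lneq.
- rewrite /rho1 exprVn sqr_sqrtr b1 b2 ?q1; last by rewrite mulr_ge0; lra.
  by field; rewrite lneq a1 a3.
- rewrite /rho2 exprVn sqr_sqrtr b1 ?q2; last by rewrite !mulr_ge0; lra.
  by field; rewrite lneq a1 a2.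
- rewrite /rho3 exprVn sqr_sqrtr b2 ?q3; last by rewrite !mulr_ge0; lra.
  by field; rewrite lneq a3 a2.
Qed.

Let kap s := c.1 / tau s ^+ 2.

Lemma explicit_frame : exists F : R -> 'M[C]_3,
  [/\ forall s, is_mxderive F s (F s *m Kmx (kap s) (tau s)),
      forall s, inG (F s),
      explicit_curve c e2 l1 l2 l3 tau r1 r2 r3 = (fun s => cline (col 0 (F s))) &
      forall s, F s *m Lmx (kap s) (tau s) (dtau s) =
                standard_momentum e2 l1 l2 l3 *m F s].
Proof.
pose N := eigen_rows c tau dtau lam z; pose B := eigen_basis eps.
have Nd s := eigen_rows_derive ode energy lam_neq lam_root zd s.
have NL s : N s *m Lmx (kap s) (tau s) (dtau s) = diag_mx (\row_j (lam j)%:C) *m N s.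
  exact: eigen_rows_momentum.
have Nh s := eigen_rows_coform ode energy lam_inj lam_neq lam_root zn s.
have F0h s : B *m N s *m hmx R *m ctr (B *m N s) = hmx R.
  rewrite ctrM -!mulmxA (mulmxA (N s)) (mulmxA (_ *m _) (ctr (N s))) Nh mulmxA.
  exact: (eigen_basis_coform epsilon_sqr).
have F0d s : is_mxderive (fun u => B *m N u) s (B *m N s *m Kmx (kap s) (tau s)).
  by rewrite -mulmxA; exact: is_mxderive_mull.
(* [om] is a cube root of the inverse of the determinant, which is constant. *)
have [om [om0 om3 omn]] := inG_scale (F0h 0).
exists (fun s => (om *: B) *m N s); split.
- by move=> s; rewrite -mulmxA; exact: is_mxderive_mull.
- move=> s; rewrite -scalemxAl; split.
    by rewrite detZ (det_frame_const s 0 F0d).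
  apply: hmx_coform.
  have -> : ctr (om *: (B *m N s)) = conjc om *: ctr (B *m N s).
    by apply/matrixP => j k; rewrite !mxE rmorphM.
  by rewrite -!scalemxAl -scalemxAr scalerA omn scale1r.
- apply/funext => s; rewrite /explicit_curve.
  (* The factor [om] does not move the line, and the first column of [N s] is (z1, z2, z3). *)
  rewrite -[LHS](cline_scale _ om0); congr (cline _).
  apply/matrixP => j k; rewrite -scalemxAl !mxE; congr (_ * _).
  have o30 : 0 = i0 :> 'I_3 by exact/val_inj.
  rewrite o30 sum3E !mxE /=.
  by move: j; apply: ord3_ind; rewrite /= /z /lam /rho /rad /= -/eps; ring.
- move=> s; rewrite -mulmxA NL -!scalemxAl -scalemxAr; congr (om *: _).
  by rewrite !mulmxA (standard_momentum_basis l1 l2 epsilon_sqr).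
Qed.

End ExplicitCurve.

(** * Comparison of an arbitrary critical curve with the explicit one *)

Lemma twist_solution_ode (R : realType) (c : R * R) (e2 : R) (tau : R -> R) :
  twist_solution c e2 tau -> forall s, twist_ode c tau (derive1 tau) s.
Proof.
move=> [_ _ _ sol] s; have [t0 td tdd e] := sol s.
split; first exact: t0.
  exact: derivable_is_derive1.
by rewrite -e; exact: derivable_is_derive1.
Qed.

Lemma col_mulmx (K : pzRingType) (m n p : nat) (A : 'M[K]_(m, n)) (B : 'M[K]_(n, p)) j :
  col j (A *m B) = A *m col j B.
Proof. by apply/matrixP => k l; rewrite !mxE; apply: eq_bigr => i _; rewrite !mxE. Qed.

(** A nonzero [c.1] keeps the twist away from 0 and determines the bending; substituting it turns
    the second Euler-Lagrange equation into the twist equation. *)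
Lemma critical_twist_ode (R : realType) (c : R * R) (J : set R)
    (g : R -> set 'cV[R[i]]_3) (F : R -> 'M[R[i]]_3) (k t : R -> R) s :
  c.1 != 0 -> critical J g F k t -> has_modulus J k t c -> J s ->
  twist_ode c t (derive1 t) s /\ k s = c.1 / t s ^+ 2.
Proof.
move=> c0 [_ _ _ [_ _ tJ _ _] el] mod Js; have [kt _] := mod s Js.
have t0 : t s != 0.
  by apply: contra_neq c0 => t0; rewrite -kt t0 expr0n mulr0.
have kE : k s = c.1 / t s ^+ 2 by rewrite -kt mulfK// expf_neq0.
split; last exact: kE.
split; [exact: t0|exact: derivable_is_derive1 (tJ 0 s Js)|].
have [_ e] := el s Js.
have /is_derive_eq := derivable_is_derive1 (tJ 1 s Js); apply.
rewrite derive1n1; apply: (eq_of_comb (k := 1) e).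
by rewrite kE; field.
Qed.

Theorem theorem3 (R : realType) (c : R * R)
  (hB : B1 c) (hgen : general c)
  (e1 e2 e3 : R) (he12 : e1 < e2) (he23 : e2 < e3)
  (he : forall x, root (Ppoly c) x = (x \in [:: e1; e2; e3]))
  (l1 l2 l3 : R) (hl12 : l1 < l2) (hl23 : l2 < l3)
  (hl : forall x, root (Qpoly c) x = (x \in [:: l1; l2; l3]))
  (tau : R -> R) (htau : twist_solution c e2 tau)
  (r1 r2 r3 : R -> R[i])
  (hr1 : sqrt_determination (fun s => 3 * (l2 + l3) + tau s ^+ 2) r1)
  (hr2 : sqrt_determination (fun s => 3 * l2 - tau s ^+ 2) r2)
  (hr3 : sqrt_determination (fun s => 3 * l3 - tau s ^+ 2) r3) :
  let gamma := explicit_curve c e2 l1 l2 l3 tau r1 r2 r3 in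
  (forall (J : set R) (g : R -> set 'cV[R[i]]_3) (F : R -> 'M[R[i]]_3)
      (k t : R -> R),
    critical_curve J g F k t -> has_modulus J k t c -> type_B1' J t c ->
    (exists s0, normalized (translate_dom s0 J) (translate s0 t) e2) /\
    (forall s0, normalized (translate_dom s0 J) (translate s0 t) e2 ->
      congruent (translate_dom s0 J) (translate s0 g) setT gamma)) /\
  in_standard_configuration setT gamma c e2 l1 l2 l3.
Proof.
move=> gamma.
have c0 := B1_c1_lt0 hB; have c0' : c.1 != 0 by rewrite lt_eqF.
have ode := twist_solution_ode htau; have [tau0 dtau0 [T T0 tauT] _] := htau.
have [F0 [F0d F0G gammaE F0L]] :=
  explicit_frame hB hgen he12 he23 he hl12 hl23 hl ode tau0 dtau0 hr1 hr2 hr3.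
have e20 := B1_e2_lt0 hB he12 he23 he; have [_ Pe2 _] := B1_root he.
(* Any time at which the twist equals [e2] fixes the whole curve. This yields both the existence of
   a normalization and the congruence for every normalization. *)
have through_e2 J g F k t s0 : critical_curve J g F k t -> has_modulus J k t c ->
    J s0 -> t s0 = e2 ->
    [/\ J = setT, forall s, t (s0 + s) = tau s &
        exists2 A, inG A & forall s, g (s0 + s) = act A (gamma s)].
  move=> [crit maxJ] mod Js0 ts0.
  pose J1 := translate_dom s0 J.
  have [[[_ iJ _] _] _ _ [FJ _ _ [[_ gE] _] FK] _] := crit.
  have iJ1 : is_interval J1.
    move=> x y J1x J1y u /andP[xu uy]; apply: (iJ _ _ J1x J1y).
    by rewrite !lerD2l xu uy.
  have J10 : J1 0 by rewrite /J1 /translate_dom /= addr0.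
  have ode1 u : J1 u ->
      twist_ode c (fun v => t (s0 + v)) (fun v => derive1 t (s0 + v)) u.
    move=> /(critical_twist_ode c0' crit mod)[[t0 td tdd] _].
    by split; [exact: t0|exact: (is_derive_shiftl td)|exact: (is_derive_shiftl tdd)].
  have t10 : t (s0 + 0) = e2 by rewrite addr0.
  (* The modulus relations amount to the energy relation, whose right side vanishes at the root
     [e2]. *)
  have dt10 : derive1 t (s0 + 0) = 0.
    rewrite addr0; have [kt m2] := mod s0 Js0; rewrite ts0 in kt m2.
    apply/eqP; rewrite -sqrf_eq0; apply/eqP.
    have e2n : e2 != 0 by rewrite lt_eqF.
    have kE : k s0 = c.1 / e2 ^+ 2 by rewrite -kt mulfK// expf_neq0.
    have : 3 / 2 * e2 ^+ 2 * derive1 t s0 ^+ 2 = (Ppoly c).[e2].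
      by rewrite horner_Ppoly -m2 kE; field.
    by rewrite Pe2 => /eqP; rewrite mulf_eq0 (negbTE (mulf_neq0 _ _)) ?expf_neq0//= => /eqP.
  have tE u : J1 u -> t (s0 + u) = tau u.
    apply: (twist_ode_unique (c := c) (tau1 := fun v => t (s0 + v))
      (dtau1 := fun v => derive1 t (s0 + v)) (dtau2 := derive1 tau)
      (ltW he12) e20 iJ1 J10) => [v J1v|v _||].
    - split; first exact: ode1.
      by have [] := twist_ode_range hB he12 he23 he iJ1 J10 ode1 t10 dt10 J1v.
    - by split=> //; exact: (twist_range hB he12 he23 he ode tau0 dtau0).
    - by rewrite t10.
    - by rewrite dt10.
  have [A GA AE] : exists2 A, inG A & forall u, J1 u -> F (s0 + u) = A *m F0 u.
    apply: (frame_unique (kappa := fun u => c.1 / tau u ^+ 2) (tau := tau) iJ1) => //.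
    - by exists 0.
    - move=> u J1u; have [FG FKu] := FK _ J1u.
      have := is_mxderive_shiftl (smooth_is_mxderive FJ J1u).
      move/is_mxderive_eq; apply; have [_ kE] := critical_twist_ode c0' crit mod J1u.
      by rewrite -tE// -kE -FKu mulmxA mulmxV ?mul1mx// inG_unit.
    - by move=> u J1u; have [] := FK _ J1u.
  have gA u : J1 u -> g (s0 + u) = act A (gamma u).
    move=> J1u; have [_ _ ->] := gE _ J1u.
    by rewrite /gamma gammaE act_cline AE// col_mulmx.
  (* The translated explicit curve extends [g], so that [maxJ] applies. *)
  have crit' : critical setT (fun v => cline (col 0 (A *m F0 (- s0 + v))))
      (fun v => A *m F0 (- s0 + v)) (fun v => c.1 / tau (- s0 + v) ^+ 2)
      (fun v => tau (- s0 + v)).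
    apply: (critical_of_frame (dtau := fun v => derive1 tau (- s0 + v))).
    - move=> v; have [t0 td tdd] := ode (- s0 + v).
      by split; [exact: t0|exact: (is_derive_shiftl td)|exact: (is_derive_shiftl tdd)].
    - move=> v; rewrite -mulmxA; apply: is_mxderive_mull.
      exact: (is_mxderive_shiftl (F0d _)).
    - by move=> v; exact: inG_mul.
  have JT : J = setT.
    apply/seteqP; split=> // x _.
    apply: (maxJ _ _ _ _ _ crit') => // v Jv.
    have J1v : J1 (- s0 + v) by rewrite /J1 /translate_dom /= addNKr.
    have := gA _ J1v; rewrite addNKr => ->.
    by rewrite /gamma gammaE act_cline col_mulmx.
  split=> //.
  - by move=> s; apply: tE; rewrite /J1 JT.
  - by exists A => // s; apply: gA; rewrite /J1 JT.
split.
- move=> J g F k t crit mod [_ _ [p Qp [cp sigJ]]].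
  have even s := (twist_even hB he12 he23 he ode tau0 dtau0 s).1.
  split.
  (* The signature fills a component containing (e2, 0), which supplies the time [s0]. *)
  + have := compact_component_e2 hB he12 he23 he Qp cp.
    rewrite -sigJ => -[s0 Js0 [ts0 _]].
    have [JT tE _] := through_e2 _ _ _ _ _ _ crit mod Js0 ts0.
    exists s0; rewrite JT; split=> //; first by rewrite /translate addr0.
    by move=> s _; rewrite /translate !tE even.
  + move=> s0 [J0 t0 _]; rewrite /translate_dom /= addr0 in J0.
    rewrite /translate addr0 in t0.
    have [JT tE [A GA gA]] := through_e2 _ _ _ _ _ _ crit mod J0 t0.
    split; first by rewrite JT.
    by exists A => // s _; exact: gA.
- exists F0, (fun s => c.1 / tau s ^+ 2), tau; split.
  (* A curve defined on the whole line is maximal. *)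
  + by split; [rewrite /gamma gammaE; exact: (critical_of_frame ode)|move=> J'].
  + exact: (twist_has_modulus hB he12 he23 he ode tau0 dtau0).
  + exact: (twist_solution_type hB he12 he23 he ode tau0 dtau0 T0 tauT).
  + by move=> s _; rewrite F0L mulmxK// inG_unit.
Qed.
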